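(* Let $(A,\Delta)$ be an algebraic quantum group and let $h$ be a central group-like projection in $A$ (i.e. $ah=ha$ for all $a\in A$). Put $A_0=Ah$ and define $\Delta_0(a)=\Delta(a)(h\otimes h)$ for $a\in A_0$. Then $(A_0,\Delta_0)$ is a compact quantum group. The Haar functional on $A_0$ is given by the restriction to $A_0$ of the left integral on $A$.
   Context: Algebras are over $\mathbb C$, possibly without identity, with non-degenerate product; $\otimes$ is the algebraic tensor product, $M(A)$ is the multiplier algebra of $A$, $\iota$ is the identity map. A multiplier Hopf $^*$-algebra is a $^*$-algebra $A$ with a non-degenerate coassociative $^*$-homomorphism $\Delta:A\to M(A\otimes A)$ such that $a\otimes b\mapsto\Delta(a)(1\otimes b)$ and $a\otimes b\mapsto(a\otimes1)\Delta(b)$ are bijections from $A\otimes A$ onto $A\otimes A$. It has a unique counit $\varepsilon$ and a unique antipode $S$. An algebraic quantum group is a multiplier Hopf $^*$-algebra with a positive left integral $\varphi$: a non-zero linear functional with $\varphi(a^*a)\ge0$ and $(\iota\otimes\varphi)\Delta(a)=\varphi(a)1$ for all $a\in A$ (integrals are then unique up to a scalar and faithful). A group-like projection is a non-zero $h\in A$ with $h^2=h=h^*$ and $\Delta(h)(1\otimes h)=h\otimes h$. A compact quantum group here means a Hopf $^*$-algebra (with identity; here the identity of $A_0$ is $h$) with a positive integral; the integral, a positive non-zero linear functional that is both left and right invariant, is its Haar functional (determined up to a scalar; it takes the value $1$ at the identity if $\varphi$ is normalized by $\varphi(h)=1$). *)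

(* Defs.v *)
From HB Require Import structures.
From mathcomp Require Import all_boot all_order all_algebra.
From mathcomp Require Import generic_quotient.
From mathcomp Require Import boolp functions.
From mathcomp Require Import complex.

Set Implicit Arguments.
Unset Strict Implicit.
Unset Printing Implicit Defensive.
Import Order.TTheory GRing.Theory Num.Theory.
Local Open Scope ring_scope.
Local Open Scope quotient_scope.

Reserved Notation "A ⊗ B" (at level 40, left associativity).
Reserved Notation "a ** b" (at level 40, left associativity).

Local Notation bilinear f := (bilinear_for *:%R *:%R f).

(* The algebraic tensor product: formal sums of pairs (a, b), where two sums are
   identified when no bilinear map on A x B separates them; scalars are absorbed
   in the first component.  [tlift_tens], [tlift_linear] and [tensor_ext] are
   the universal property. *)
Section Tensor.
Variables (K : fieldType) (A B : lmodType K).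
Implicit Types (s t : seq (A * B)) (W : lmodType K).

Definition tsum (W : nmodType) (f : A -> B -> W) s : W :=
  \sum_(p <- s) f p.1 p.2.

Definition teq s t : bool :=
  `[< forall W (f : A -> B -> W), bilinear f -> tsum f s = tsum f t >].

Lemma teq_equiv : equiv_class_of teq.
Proof.
split.
- by move=> s; apply/asboolP.
- by move=> s t; apply: asbool_equiv_eq; split=> H W f hf; rewrite (H W f hf).
- move=> t s u /asboolP H1 /asboolP H2; apply/asboolP => W f hf.
  by rewrite (H1 W f hf) (H2 W f hf).
Qed.

Canonical teq_equivrel := EquivRelPack teq_equiv.

Definition tensor := {eq_quot teq_equivrel}.
HB.instance Definition _ := Choice.on tensor.
HB.instance Definition _ := EqQuotient.on tensor.

Definition tens (a : A) (b : B) : tensor := \pi_tensor [:: (a, b)].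

(* The linear map on the tensor product induced by f, when f is bilinear. *)
Definition tlift (W : nmodType) (f : A -> B -> W) (x : tensor) : W :=
  tsum f (repr x).

Lemma tlift_pi W (f : A -> B -> W) s :
  bilinear f -> tlift f (\pi_tensor s) = tsum f s.
Proof.
move=> hf; have /eqquotP/asboolP H : \pi_tensor (repr (\pi_tensor s)) = \pi_tensor s.
  exact: reprK.
exact: H.
Qed.

Lemma tlift_eq (x y : tensor) :
  (forall W (f : A -> B -> W), bilinear f -> tlift f x = tlift f y) -> x = y.
Proof. by move=> H; rewrite -[x]reprK -[y]reprK; apply/eqquotP/asboolP. Qed.

Definition tscale (c : K) (x : tensor) : tensor :=
  \pi_tensor [seq (c *: p.1, p.2) | p <- repr x].
Definition tzero : tensor := \pi_tensor [::].
Definition tadd (x y : tensor) : tensor := \pi_tensor (repr x ++ repr y).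
Definition topp (x : tensor) : tensor := tscale (-1) x.

Lemma bilinearZl W (f : A -> B -> W) c a b :
  bilinear f -> f (c *: a) b = c *: f a b.
Proof. by case=> hl _; have /= -> := scalable_linear (hl b). Qed.
Lemma bilinearZr W (f : A -> B -> W) c a b :
  bilinear f -> f a (c *: b) = c *: f a b.
Proof. by case=> _ hr; have /= -> := scalable_linear (hr a). Qed.

Lemma tlift_zero W (f : A -> B -> W) : bilinear f -> tlift f tzero = 0.
Proof. by move=> hf; rewrite tlift_pi // /tsum big_nil. Qed.
Lemma tlift_add W (f : A -> B -> W) x y :
  bilinear f -> tlift f (tadd x y) = tlift f x + tlift f y.
Proof. by move=> hf; rewrite tlift_pi // /tsum big_cat. Qed.
Lemma tlift_scale W (f : A -> B -> W) c x :
  bilinear f -> tlift f (tscale c x) = c *: tlift f x.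
Proof.
move=> hf; rewrite tlift_pi // /tlift /tsum big_map scaler_sumr.
by apply: eq_bigr => p _ /=; rewrite bilinearZl.
Qed.

Lemma taddA : associative tadd.
Proof. by move=> x y z; apply: tlift_eq => W f hf; rewrite !tlift_add // addrA. Qed.
Lemma taddC : commutative tadd.
Proof. by move=> x y; apply: tlift_eq => W f hf; rewrite !tlift_add // addrC. Qed.
Lemma tadd0 : left_id tzero tadd.
Proof.
by move=> x; apply: tlift_eq => W f hf; rewrite tlift_add // tlift_zero // add0r.
Qed.
Lemma taddN : left_inverse tzero topp tadd.
Proof.
move=> x; apply: tlift_eq => W f hf.
by rewrite tlift_add // tlift_scale // tlift_zero // scaleN1r addNr.
Qed.
HB.instance Definition _ := GRing.isZmodule.Build tensor taddA taddC tadd0 taddN.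

Lemma tscaleA a b x : tscale a (tscale b x) = tscale (a * b) x.
Proof. by apply: tlift_eq => W f hf; rewrite !tlift_scale // scalerA. Qed.
Lemma tscale1 : left_id 1 tscale.
Proof. by move=> x; apply: tlift_eq => W f hf; rewrite tlift_scale // scale1r. Qed.
Lemma tscaleDr : right_distributive tscale +%R.
Proof.
move=> c x y; apply: tlift_eq => W f hf.
by rewrite tlift_scale // !tlift_add // !tlift_scale // scalerDr.
Qed.
Lemma tscaleDl x : {morph tscale^~ x : a b / a + b}.
Proof.
move=> a b; apply: tlift_eq => W f hf.
by rewrite tlift_add // !tlift_scale // scalerDl.
Qed.
HB.instance Definition _ :=
  GRing.Zmodule_isLmodule.Build K tensor tscaleA tscale1 tscaleDr tscaleDl.

Lemma tlift_linear W (f : A -> B -> W) : bilinear f -> linear (tlift f).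
Proof. by move=> hf c x y; rewrite tlift_add // tlift_scale. Qed.

Lemma tlift_tens W (f : A -> B -> W) a b : bilinear f -> tlift f (tens a b) = f a b.
Proof. by move=> hf; rewrite tlift_pi // /tsum big_seq1. Qed.

Lemma tens_bilinear : bilinear tens.
Proof.
split=> [b|a] c x y; apply: tlift_eq => W f hf;
  rewrite tlift_linear // !tlift_tens //; case: (hf) => hl hr.
- exact: hl.
- exact: hr.
Qed.

Lemma tensor_sum (x : tensor) : x = \sum_(p <- repr x) tens p.1 p.2.
Proof.
apply: tlift_eq => W f hf.
rewrite {1}/tlift /tsum.
elim: (repr x) => [|p s IH]; first by rewrite !big_nil tlift_zero.
by rewrite !big_cons IH tlift_add // tlift_tens.
Qed.

Lemma linear_sum_seq (U W : lmodType K) (f : U -> W) : linear f ->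
  forall (I : Type) (s : seq I) (F : I -> U),
  f (\sum_(i <- s) F i) = \sum_(i <- s) f (F i).
Proof.
move=> hf I s F; elim: s => [|i s IH]; rewrite ?big_nil ?big_cons.
  by have /= := scalable_linear hf 0 0; rewrite !scale0r.
by rewrite -IH -[F i]scale1r hf !scale1r.
Qed.

Lemma tensor_ext W (f g : tensor -> W) : linear f -> linear g ->
  (forall a b, f (tens a b) = g (tens a b)) -> f =1 g.
Proof.
move=> hf hg H x; rewrite (tensor_sum x) !linear_sum_seq //.
by apply: eq_bigr => p _; rewrite H.
Qed.

End Tensor.

Notation "A ⊗ B" := (tensor A%type B%type) : type_scope.
Notation "a ⊗ b" := (tens a b) : ring_scope.

(* *-algebras, possibly without identity. *)
HB.mixin Record isStarAlgebra (K : numClosedFieldType) A of GRing.Lmodule K A := {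
  smul : A -> A -> A;
  star : A -> A;
  smul_bilinear : bilinear_for *:%R *:%R smul;
  smulA : associative smul;
  starP : forall c a b, star (c *: a + b) = c^* *: star a + star b;
  starM : forall a b, star (smul a b) = smul (star b) (star a);
  starK : involutive star
}.

#[short(type="starAlgType")]
HB.structure Definition StarAlgebra (K : numClosedFieldType) :=
  { A of isStarAlgebra K A & GRing.Lmodule K A }.

Notation "a ** b" := (smul a b) : ring_scope.

(* The complex conjugate vector space, used to factor antilinear maps. *)
Definition conjmod (K : numClosedFieldType) (V : lmodType K) : Type := V.

Arguments conjmod {K} V%_type.

Section ConjMod.
Variables (K : numClosedFieldType) (V : lmodType K).
HB.instance Definition _ := GRing.Zmodule.on (conjmod V).
Definition conj_scale (c : K) (v : conjmod V) : conjmod V := c^* *: (v : V).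
Lemma conj_scaleA a b v : conj_scale a (conj_scale b v) = conj_scale (a * b) v.
Proof. by rewrite /conj_scale scalerA rmorphM. Qed.
Lemma conj_scale1 : left_id 1 conj_scale.
Proof. by move=> v; rewrite /conj_scale rmorph1 scale1r. Qed.
Lemma conj_scaleDr : right_distributive conj_scale +%R.
Proof. by move=> c u v; rewrite /conj_scale scalerDr. Qed.
Lemma conj_scaleDl v : {morph conj_scale^~ v : a b / a + b}.
Proof. by move=> a b; rewrite /conj_scale rmorphD scalerDl. Qed.
HB.instance Definition _ := GRing.Zmodule_isLmodule.Build K (conjmod V)
  conj_scaleA conj_scale1 conj_scaleDr conj_scaleDl.
End ConjMod.

Section StarAlgTheory.
Variables (K : numClosedFieldType) (A : starAlgType K).
Implicit Types (a b x y : A) (c : K).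

Lemma smulPl a c x y : (c *: x + y) ** a = c *: (x ** a) + y ** a.
Proof. by case: (@smul_bilinear K A) => + _; apply. Qed.
Lemma smulPr a c x y : a ** (c *: x + y) = c *: (a ** x) + a ** y.
Proof. by case: (@smul_bilinear K A) => _; apply. Qed.
Lemma smul0l a : 0 ** a = 0.
Proof.
case: (@smul_bilinear K A) => H _.
by have /= := scalable_linear (H a) 0 0; rewrite !scale0r.
Qed.
Lemma smul0r a : a ** 0 = 0.
Proof.
case: (@smul_bilinear K A) => _ H.
by have /= := scalable_linear (H a) 0 0; rewrite !scale0r.
Qed.
End StarAlgTheory.

Section TensorMap.
Variables (K : fieldType).
Local Notation linear f := (GRing.linear_for *:%R f).

Definition tmap (A B A' B' : lmodType K) (f : A -> A') (g : B -> B') : A ⊗ B -> A' ⊗ B' :=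
  tlift (fun a b => f a ⊗ g b).

Lemma tmap_bilinear (A B A' B' : lmodType K) (f : A -> A') (g : B -> B') :
  linear f -> linear g -> bilinear (fun a b => f a ⊗ g b).
Proof.
move=> hf hg; case: (tens_bilinear A' B') => hl hr; split=> [b|a] c x y /=.
- by rewrite hf hl.
- by rewrite hg hr.
Qed.

Lemma tmap_linear (A B A' B' : lmodType K) (f : A -> A') (g : B -> B') :
  linear f -> linear g -> linear (tmap f g).
Proof. by move=> hf hg; apply: tlift_linear; apply: tmap_bilinear. Qed.

Lemma tmap_tens (A B A' B' : lmodType K) (f : A -> A') (g : B -> B') a b :
  linear f -> linear g -> tmap f g (a ⊗ b) = f a ⊗ g b.
Proof. by move=> hf hg; rewrite /tmap tlift_tens //; apply: tmap_bilinear. Qed.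

Definition tassoc (A B C : lmodType K) : (A ⊗ B) ⊗ C -> A ⊗ (B ⊗ C) :=
  tlift (fun x c => tlift (fun a b => a ⊗ (b ⊗ c)) x).

Lemma tassoc_bilinear1 (A B C : lmodType K) (c : C) :
  bilinear (fun (a : A) (b : B) => a ⊗ (b ⊗ c)).
Proof.
split=> [b|a] k x y /=.
- by rewrite (tens_bilinear _ _).1.
- by rewrite (tens_bilinear _ _).1 (tens_bilinear _ _).2.
Qed.

Lemma tassoc_bilinear (A B C : lmodType K) :
  bilinear (fun (x : A ⊗ B) (c : C) => tlift (fun a b => a ⊗ (b ⊗ c)) x).
Proof.
split=> [c|x] k y z /=.
  by rewrite tlift_linear //; apply: tassoc_bilinear1.
rewrite /tlift /tsum scaler_sumr -big_split; apply: eq_bigr => p _ /=.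
by rewrite !(tens_bilinear _ _).2.
Qed.

Lemma tassoc_linear (A B C : lmodType K) : linear (@tassoc A B C).
Proof. exact: tlift_linear (@tassoc_bilinear A B C). Qed.

Lemma tassoc_tens (A B C : lmodType K) (a : A) (b : B) (c : C) :
  tassoc ((a ⊗ b) ⊗ c) = a ⊗ (b ⊗ c).
Proof.
rewrite /tassoc tlift_tens; last exact: tassoc_bilinear.
by rewrite tlift_tens //; apply: tassoc_bilinear1.
Qed.

(* iota (x) phi and phi (x) iota *)
Definition slicer (A B : lmodType K) (phi : B -> K) : A ⊗ B -> A :=
  tlift (fun a b => phi b *: a).
Definition slicel (A B : lmodType K) (phi : A -> K) : A ⊗ B -> B :=
  tlift (fun a b => phi a *: b).

Lemma slicer_bilinear (A B : lmodType K) (phi : B -> K) :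
  scalar phi -> bilinear (fun (a : A) b => phi b *: a).
Proof.
move=> hp; split=> [b|a] c x y /=; first by rewrite scalerDr !scalerA mulrC.
by rewrite hp scalerDl scalerA.
Qed.
Lemma slicel_bilinear (A B : lmodType K) (phi : A -> K) :
  scalar phi -> bilinear (fun a (b : B) => phi a *: b).
Proof.
move=> hp; split=> [b|a] c x y /=; last by rewrite scalerDr !scalerA mulrC.
by rewrite hp scalerDl scalerA.
Qed.

Lemma slicer_tens (A B : lmodType K) (phi : B -> K) (a : A) b :
  scalar phi -> slicer phi (a ⊗ b) = phi b *: a.
Proof. by move=> hp; rewrite /slicer tlift_tens //; apply: slicer_bilinear. Qed.
Lemma slicel_tens (A B : lmodType K) (phi : A -> K) a (b : B) :
  scalar phi -> slicel phi (a ⊗ b) = phi a *: b.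
Proof. by move=> hp; rewrite /slicel tlift_tens //; apply: slicel_bilinear. Qed.
End TensorMap.

(* The tensor product *-algebra: (a ⊗ b)(c ⊗ d) = ac ⊗ bd, (a ⊗ b)^* = a^* ⊗ b^*. *)
Section TensorAlgebra.
Variables (K : numClosedFieldType) (A B : starAlgType K).
Implicit Types (x y z : A ⊗ B).

Definition tmul x y : A ⊗ B :=
  tlift (fun a b => tmap (fun c => a ** c) (fun d => b ** d) y) x.
Definition tstar x : A ⊗ B :=
  tlift (fun a b => star a ⊗ star b : conjmod (A ⊗ B)) x.

Lemma tmul_bilinear1 y :
  bilinear (fun a b => tmap (fun c => a ** c) (fun d => b ** d) y).
Proof.
have hl := (tens_bilinear A B).1; have hr := (tens_bilinear A B).2.
split=> [b|a] k u v; rewrite /= /tmap /tlift /tsum scaler_sumr -big_split;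
  apply: eq_bigr => p _ /=; rewrite smulPl; [exact: hl|exact: hr].
Qed.

Lemma tmul_bilinear : bilinear tmul.
Proof.
split=> [y|x] k u v /=; first by rewrite /tmul tlift_linear //; apply: tmul_bilinear1.
rewrite /tmul /tlift /tsum scaler_sumr -big_split; apply: eq_bigr => p _ /=.
by apply: tmap_linear => ? ? ?; rewrite smulPr.
Qed.

Lemma tmul_tens a b c d : tmul (a ⊗ b) (c ⊗ d) = (a ** c) ⊗ (b ** d).
Proof.
rewrite /tmul tlift_tens; last exact: tmul_bilinear1.
by apply: tmap_tens => ? ? ?; rewrite smulPr.
Qed.

Lemma tstar_bilinear : bilinear (fun a b => star a ⊗ star b : conjmod (A ⊗ B)).
Proof.
have hl := (tens_bilinear A B).1; have hr := (tens_bilinear A B).2.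
by split=> [b|a] k x y; rewrite /= starP; [apply: hl|apply: hr].
Qed.

Lemma tstarP c x y : tstar (c *: x + y) = c^* *: tstar x + tstar y.
Proof. exact: (tlift_linear tstar_bilinear). Qed.

Lemma tstar_tens a b : tstar (a ⊗ b) = star a ⊗ star b.
Proof. exact: (tlift_tens _ _ tstar_bilinear). Qed.

Lemma tmulA : associative tmul.
Proof.
have hl := tmul_bilinear.1; have hr := tmul_bilinear.2.
move=> x y z; move: x; apply: tensor_ext.
- by move=> c u v; rewrite hl.
- by move=> c u v; rewrite !hl.
move=> a b; move: y; apply: tensor_ext.
- by move=> c u v; rewrite hl hr.
- by move=> c u v; rewrite hr hl.
move=> a' b'; move: z; apply: tensor_ext.
- by move=> c u v; rewrite !hr.
- by move=> c u v; rewrite !hr.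
by move=> a'' b''; rewrite !tmul_tens !smulA.
Qed.

Lemma tstarM x y : tstar (tmul x y) = tmul (tstar y) (tstar x).
Proof.
have hl := tmul_bilinear.1; have hr := tmul_bilinear.2.
move: x; apply: (@tensor_ext _ _ _ (conjmod (A ⊗ B))).
- by move=> c u v /=; rewrite hl tstarP.
- by move=> c u v /=; rewrite tstarP hr.
move=> a b; move: y; apply: (@tensor_ext _ _ _ (conjmod (A ⊗ B))).
- by move=> c u v /=; rewrite hr tstarP.
- by move=> c u v /=; rewrite tstarP hl.
by move=> c d; rewrite tmul_tens !tstar_tens tmul_tens !starM.
Qed.

Lemma tstarK : involutive tstar.
Proof.
apply: tensor_ext => [c u v|c u v|a b] //=.
- by rewrite !tstarP conjCK.
- by rewrite !tstar_tens !starK.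
Qed.

HB.instance Definition _ := isStarAlgebra.Build K (A ⊗ B)%type
  tmul_bilinear tmulA tstarP tstarM tstarK.
End TensorAlgebra.

(* M(A): pairs (L, R) of a left and a right multiplier of A with a L(b) = R(a) b. *)
Section Multiplier.
Variables (K : numClosedFieldType) (A : starAlgType K).

Definition multiplier_pred : {pred (A -> A) * (A -> A)} := fun m =>
  `[< [/\ linear m.1, linear m.2,
          forall a b, m.1 (a ** b) = m.1 a ** b,
          forall a b, m.2 (a ** b) = a ** m.2 b
        & forall a b, a ** m.1 b = m.2 a ** b] >].

Record multiplier := Multiplier {
  mpair : (A -> A) * (A -> A); _ : mpair \in multiplier_pred }.

HB.instance Definition _ := [isSub for mpair].
HB.instance Definition _ := [Choice of multiplier by <:].

Lemma multiplier_submod : submod_closed multiplier_pred.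
Proof.
split.
  apply/asboolP; split=> [c x y|c x y|a b|a b|a b] /=;
    by rewrite ?scaler0 ?addr0 ?smul0l ?smul0r.
move=> k m n /asboolP[m1 m2 m3 m4 m5] /asboolP[n1 n2 n3 n4 n5].
have E1 a : (k *: m + n).1 a = k *: m.1 a + n.1 a by [].
have E2 a : (k *: m + n).2 a = k *: m.2 a + n.2 a by [].
apply/asboolP; split=> [c x y|c x y|a b|a b|a b]; rewrite ?E1 ?E2.
- by rewrite m1 n1 !scalerDr !scalerA addrACA (mulrC k).
- by rewrite m2 n2 !scalerDr !scalerA addrACA (mulrC k).
- by rewrite m3 n3 smulPl.
- by rewrite m4 n4 smulPr.
- by rewrite smulPl smulPr m5 n5.
Qed.

HB.instance Definition _ :=
  GRing.SubChoice_isSubLmodule.Build K _ multiplier_pred multiplier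
    (GRing.submod_closed_semi multiplier_submod).

Definition ml (m : multiplier) : A -> A := (mpair m).1.
Definition mr (m : multiplier) : A -> A := (mpair m).2.

Lemma multiplierP (m : multiplier) :
  [/\ linear (ml m), linear (mr m),
      forall a b, ml m (a ** b) = ml m a ** b,
      forall a b, mr m (a ** b) = a ** mr m b
    & forall a b, a ** ml m b = mr m a ** b].
Proof. by apply/asboolP; apply: (valP m). Qed.

Lemma multiplier_eq (m n : multiplier) : ml m =1 ml n -> mr m =1 mr n -> m = n.
Proof.
move=> /funext h1 /funext h2; apply: val_inj; move: h1 h2; rewrite /ml /mr /=.
by case: (mpair m) => ? ?; case: (mpair n) => ? ? /= -> ->.
Qed.

Lemma mlP c (m n : multiplier) a : ml (c *: m + n) a = c *: ml m a + ml n a.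
Proof. by []. Qed.
Lemma mrP c (m n : multiplier) a : mr (c *: m + n) a = c *: mr m a + mr n a.
Proof. by []. Qed.

Fact mone_subproof : (idfun, idfun) \in multiplier_pred.
Proof. exact/asboolP. Qed.
Definition mone : multiplier := Multiplier mone_subproof.

Fact memb_subproof a : (smul a, smul^~ a) \in multiplier_pred.
Proof.
apply/asboolP; split=> [c x y|c x y|x y|x y|x y] /=.
- exact: smulPr.
- exact: smulPl.
- exact: smulA.
- by rewrite smulA.
- exact: smulA.
Qed.
(* The canonical map A -> M(A), injective when the product is non-degenerate. *)
Definition memb a : multiplier := Multiplier (memb_subproof a).

Fact mmul_subproof m n : (ml m \o ml n, mr n \o mr m) \in multiplier_pred.
Proof.
have [m1 m2 m3 m4 m5] := multiplierP m; have [n1 n2 n3 n4 n5] := multiplierP n.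
apply/asboolP; split=> [c x y|c x y|x y|x y|x y] /=.
- by rewrite n1 m1.
- by rewrite m2 n2.
- by rewrite n3 m3.
- by rewrite m4 n4.
- by rewrite m5 n5.
Qed.
Definition mmul m n : multiplier := Multiplier (mmul_subproof m n).

Fact mstar_subproof m :
  (fun a => star (mr m (star a)), fun a => star (ml m (star a))) \in multiplier_pred.
Proof.
have [m1 m2 m3 m4 m5] := multiplierP m.
apply/asboolP; split=> [c x y|c x y|x y|x y|x y] /=.
- by rewrite starP m2 starP conjCK.
- by rewrite starP m1 starP conjCK.
- by rewrite starM m4 starM starK.
- by rewrite starM m3 starM starK.
- by apply: (can_inj (@starK _ _)); rewrite !starM !starK -m5.
Qed.
Definition mstar m : multiplier := Multiplier (mstar_subproof m).

Lemma ml_mul m n a : ml (mmul m n) a = ml m (ml n a). Proof. by []. Qed.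
Lemma mr_mul m n a : mr (mmul m n) a = mr n (mr m a). Proof. by []. Qed.
Lemma ml_star m a : ml (mstar m) a = star (mr m (star a)). Proof. by []. Qed.
Lemma mr_star m a : mr (mstar m) a = star (ml m (star a)). Proof. by []. Qed.

Lemma mmul_bilinear : bilinear mmul.
Proof.
split=> [n|m] c x y; apply: multiplier_eq => a /=; rewrite ?mlP ?mrP //.
- by have [_ + _ _ _] := multiplierP n; apply.
- by have [+ _ _ _ _] := multiplierP m; apply.
Qed.
Lemma mmulA : associative mmul.
Proof. by move=> m n p; apply: multiplier_eq. Qed.
Lemma mstarP c m n : mstar (c *: m + n) = c^* *: mstar m + mstar n.
Proof.
by apply: multiplier_eq => a; rewrite ?mlP ?mrP ?ml_star ?mr_star ?mlP ?mrP starP.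
Qed.
Lemma mstarM m n : mstar (mmul m n) = mmul (mstar n) (mstar m).
Proof. by apply: multiplier_eq => a; rewrite ?(ml_star, mr_star, ml_mul, mr_mul) !starK. Qed.
Lemma mstarK : involutive mstar.
Proof. by move=> m; apply: multiplier_eq => a; rewrite ?(ml_star, mr_star) !starK. Qed.

HB.instance Definition _ := isStarAlgebra.Build K multiplier
  mmul_bilinear mmulA mstarP mstarM mstarK.

End Multiplier.

Arguments multiplier {K} A%_type.
Arguments mone {K} A.

(* m ⊗ n as a multiplier of A ⊗ B *)
Section MultiplierTensor.
Variables (K : numClosedFieldType) (A B : starAlgType K).

Fact mtens_subproof (m : multiplier A) (n : multiplier B) :
  (tmap (ml m) (ml n), tmap (mr m) (mr n)) \in @multiplier_pred K (A ⊗ B)%type.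
Proof.
have [m1 m2 m3 m4 m5] := multiplierP m; have [n1 n2 n3 n4 n5] := multiplierP n.
have L1 := tmap_linear m1 n1; have L2 := tmap_linear m2 n2.
have E1 a b := tmap_tens a b m1 n1; have E2 a b := tmap_tens a b m2 n2.
have T (a : A) (b : B) c d : (a ⊗ b) ** (c ⊗ d) = (a ** c) ⊗ (b ** d).
  exact: tmul_tens.
apply/asboolP; split=> //= x y; move: x; apply: tensor_ext;
  try (by move=> c u v; rewrite ?L1 ?L2 ?smulPl ?smulPr ?L1 ?L2 ?smulPl ?smulPr);
  move=> a b; move: y; apply: tensor_ext;
  try (by move=> c u v; rewrite ?L1 ?L2 ?smulPl ?smulPr ?L1 ?L2 ?smulPl ?smulPr);
  move=> c d; rewrite ?T ?E1 ?E2 ?T.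
- by rewrite m3 n3.
- by rewrite m4 n4.
- by rewrite m5 n5.
Qed.
Definition mtens (m : multiplier A) (n : multiplier B) : multiplier (A ⊗ B) :=
  Multiplier (mtens_subproof m n).
End MultiplierTensor.

Section Notions.
Variable K : numClosedFieldType.
Implicit Types A B : starAlgType K.

Definition nondegenerate A :=
  (forall a : A, (forall b, a ** b = 0) -> a = 0) /\
  (forall a : A, (forall b, b ** a = 0) -> a = 0).

Definition star_hom A B (f : A -> B) :=
  [/\ linear f, {morph f : a b / a ** b} & {morph f : a / star a}].

(* f(A)B and Bf(A) span B *)
Definition nondegenerate_hom A B (f : A -> multiplier B) :=
  (forall y, exists s : seq (A * B), y = \sum_(p <- s) ml (f p.1) p.2) /\
  (forall y, exists s : seq (A * B), y = \sum_(p <- s) mr (f p.1) p.2).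

(* n is the value at m of the unique extension M(A) -> M(B) of the non-degenerate
   homomorphism f : A -> M(B). *)
Definition hom_extends A B (f : A -> multiplier B) (m : multiplier A) (n : multiplier B) :=
  forall a, n ** f a = f (ml m a) /\ f a ** n = f (mr m a).

(* Delta (x) iota and iota (x) Delta on A ⊗ A *)
Definition comult_l A (D : A -> multiplier (A ⊗ A)) :
    A ⊗ A -> multiplier ((A ⊗ A) ⊗ A) :=
  tlift (fun a b => mtens (D a) (memb b)).
Definition comult_r A (D : A -> multiplier (A ⊗ A)) :
    A ⊗ A -> multiplier (A ⊗ (A ⊗ A)) :=
  tlift (fun a b => mtens (memb a) (D b)).

(* (Delta (x) iota) Delta = (iota (x) Delta) Delta, both sides being computed with
   the extensions to M(A ⊗ A). *)
Definition coassociative A (D : A -> multiplier (A ⊗ A)) :=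
  forall a, exists m n, [/\ hom_extends (comult_l D) (D a) m,
    hom_extends (comult_r D) (D a) n,
    forall x, tassoc (ml m x) = ml n (tassoc x)
  & forall x, tassoc (mr m x) = mr n (tassoc x)].

(* The linear map T, a priori valued in M(A ⊗ A), is a bijection onto A ⊗ A. *)
Definition bijective_onto_tensor A (T : A ⊗ A -> multiplier (A ⊗ A)) :=
  exists2 T0 : A ⊗ A -> A ⊗ A, bijective T0 & forall x, T x = memb (T0 x).

Definition multiplier_hopf_star A (D : A -> multiplier (A ⊗ A)) :=
  [/\ nondegenerate A, star_hom D, nondegenerate_hom D, coassociative D &
      bijective_onto_tensor (tlift (fun a b => D a ** mtens (mone A) (memb b))) /\
      bijective_onto_tensor (tlift (fun a b => mtens (memb a) (mone A) ** D b))].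

(* m = (iota (x) phi)(M), i.e. m b = (iota (x) phi)(M (b ⊗ 1)) and
   b m = (iota (x) phi)((b ⊗ 1) M); the arguments on the right lie in A ⊗ A. *)
Definition is_slicer A (phi : A -> K) (M : multiplier (A ⊗ A)) (m : multiplier A) :=
  forall b,
    (exists2 x, M ** mtens (memb b) (mone A) = memb x & ml m b = slicer phi x) /\
    (exists2 x, mtens (memb b) (mone A) ** M = memb x & mr m b = slicer phi x).

Definition nonzero_positive A (phi : A -> K) :=
  [/\ scalar phi, exists a, phi a != 0 & forall a, 0 <= phi (star a ** a)].

Definition positive_left_integral A (D : A -> multiplier (A ⊗ A)) (phi : A -> K) :=
  nonzero_positive phi /\ forall a, is_slicer phi (D a) (phi a *: mone A).

Definition algebraic_quantum_group A (D : A -> multiplier (A ⊗ A)) :=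
  multiplier_hopf_star D /\ exists phi, positive_left_integral D phi.

Definition projection A (h : A) := h ** h = h /\ star h = h.

Definition central A (h : A) := forall a, a ** h = h ** a.

Definition group_like_projection A (D : A -> multiplier (A ⊗ A)) (h : A) :=
  [/\ h != 0, projection h & D h ** mtens (mone A) (memb h) = memb (h ⊗ h)].

Lemma group_like_projection_proj A (D : A -> multiplier (A ⊗ A)) (h : A) :
  group_like_projection D h -> projection h.
Proof. by case. Qed.

(* Hopf *-algebras, on a *-algebra with identity [one] *)

Definition is_identity A (one : A) := forall a, one ** a = a /\ a ** one = a.

Definition is_counit A (one : A) (D : A -> A ⊗ A) (eps : A -> K) :=
  [/\ scalar eps, eps one = 1, {morph eps : a b / a ** b >-> a * b},
      forall a, slicel eps (D a) = a & forall a, slicer eps (D a) = a].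

Definition is_antipode A (one : A) (D : A -> A ⊗ A) (eps : A -> K) (S : A -> A) :=
  [/\ linear S,
      forall a, tlift smul (tmap S idfun (D a)) = eps a *: one
    & forall a, tlift smul (tmap idfun S (D a)) = eps a *: one].

Definition hopf_star_algebra A (one : A) (D : A -> A ⊗ A) :=
  [/\ is_identity one, star_hom D, D one = one ⊗ one,
      forall a, tassoc (tmap D idfun (D a)) = tmap idfun D (D a)
    & exists eps S, is_counit one D eps /\ is_antipode one D eps S].

Definition is_haar A (one : A) (D : A -> A ⊗ A) (psi : A -> K) :=
  [/\ nonzero_positive psi,
      forall a, slicer psi (D a) = psi a *: one
    & forall a, slicel psi (D a) = psi a *: one].

Definition compact_quantum_group A (one : A) (D : A -> A ⊗ A) :=
  hopf_star_algebra one D /\ exists psi, is_haar one D psi.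

End Notions.

(* The *-algebra Ah, for a central projection h *)
Section Corner.
Variables (K : numClosedFieldType) (A : starAlgType K) (h : A).

Definition corner_pred : {pred A} := fun x => `[< exists a, x = a ** h >].

(* The proofs are parameters so that the *-algebra structure can be inferred. *)
Record corner (hp : projection h) (hc : central h) := Corner {
  corner_val : A; _ : corner_val \in corner_pred }.

Lemma corner_submod : submod_closed corner_pred.
Proof.
split; first by apply/asboolP; exists 0; rewrite smul0l.
move=> k x y /asboolP[a ->] /asboolP[b ->]; apply/asboolP.
by exists (k *: a + b); rewrite smulPl.
Qed.

Variables (hp : projection h) (hc : central h).
Local Notation Ah := (corner hp hc).
Local Notation MkAh := (@Corner hp hc).

HB.instance Definition _ := [isSub of Ah for @corner_val hp hc].
HB.instance Definition _ := [Choice of Ah by <:].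

HB.instance Definition _ :=
  GRing.SubChoice_isSubLmodule.Build K _ corner_pred Ah
    (GRing.submod_closed_semi corner_submod).

Fact cmul_subproof (x y : Ah) : corner_val x ** corner_val y \in corner_pred.
Proof.
have /asboolP[b e] := valP y; apply/asboolP.
by exists (corner_val x ** b); rewrite -smulA -e.
Qed.
Definition cmul x y : Ah := MkAh (cmul_subproof x y).

Fact cstar_subproof (x : Ah) : star (corner_val x) \in corner_pred.
Proof.
have /asboolP[a e] := valP x; have [_ hs] := hp; apply/asboolP.
by exists (star a); rewrite [corner_val x]e starM hs hc.
Qed.
Definition cstar x : Ah := MkAh (cstar_subproof x).

Fact corner_one_subproof : h \in corner_pred.
Proof. by apply/asboolP; exists h; case: hp. Qed.
Definition corner_one : Ah := MkAh corner_one_subproof.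

Lemma cmul_bilinear : bilinear cmul.
Proof.
split=> [y|x] c u v; apply: val_inj => /=; [exact: smulPl|exact: smulPr].
Qed.
Lemma cmulA : associative cmul.
Proof. by move=> x y z; apply: val_inj; apply: smulA. Qed.
Lemma cstarP c x y : cstar (c *: x + y) = c^* *: cstar x + cstar y.
Proof. by apply: val_inj; apply: starP. Qed.
Lemma cstarM x y : cstar (cmul x y) = cmul (cstar y) (cstar x).
Proof. by apply: val_inj; apply: starM. Qed.
Lemma cstarK : involutive cstar.
Proof. by move=> x; apply: val_inj; apply: starK. Qed.

HB.instance Definition _ := isStarAlgebra.Build K Ah
  cmul_bilinear cmulA cstarP cstarM cstarK.

(* The inclusion of Ah ⊗ Ah in A ⊗ A. *)
Definition corner_tensor_incl : Ah ⊗ Ah -> A ⊗ A :=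
  tmap (@corner_val hp hc) (@corner_val hp hc).

End Corner.

(* Main.v *)
(** With T1 (a ⊗ b) = D(a)(1 ⊗ b) and T2 (a ⊗ b) = (a ⊗ 1)D(b), group-likeness and
    centrality of h give T1 (ah ⊗ bh) = T1 (a ⊗ b)(h ⊗ h), so T1 restricts to a
    bijection of Ah ⊗ Ah; together with the counit of A this yields the antipode
    of Ah.  The antipode of Ah makes the map (a ⊗ 1) D0(b) on Ah ⊗ Ah injective,
    which forces (h ⊗ 1)D(h) = h ⊗ h, and then left invariance of phi passes to Ah.
    Right invariance follows because phi o S is right invariant and therefore
    proportional to phi.  Finally phi(h) <> 0: otherwise phi(xhy) = 0 for all x, y
    by the Cauchy-Schwarz inequality, hence phi(x h_2 y) h_1 = 0 by left
    invariance, and x c S(h_1) h_2 z y = x c z y gives phi = 0. *)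

Require Import Defs.
From HB Require Import structures.
From mathcomp Require Import all_boot all_order all_algebra.
From mathcomp Require Import boolp classical_sets reals complex.

Set Implicit Arguments.
Unset Strict Implicit.
Unset Printing Implicit Defensive.
Import Order.TTheory GRing.Theory Num.Theory.
Local Open Scope ring_scope.

(** The assumption on [h] is one-sided, and so is left invariance: iota ⊗ phi can be evaluated on (h
    ⊗ 1)Delta(a), whereas an extra factor 1 ⊗ h would stay trapped inside phi. Hence (h ⊗ 1)Delta(h)
    = h ⊗ h is really needed, but at the outset only T1 is known to respect h ⊗ h. The way round is
    to obtain the antipode of Ah from T1 and let this antipode supply the missing identity for T2.
    Counit and antipode of A are not part of the data. Coassociativity enters only as a commutation
    relation: T2 on legs 1, 2 commutes with T1 on legs 2, 3. It forces multiplication after T1^-1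
    and multiplication after T2^-1 to act by one common scalar, the counit. The antipode S of A
    occurs only in products c S(u). Faithfulness of phi would give phi(h) = phi(h^* h) <> 0 at once,
    but it is not contained in the definition of a positive left integral; this is why phi(h) <> 0
    takes a separate argument. The scalar phi(h) is then cancelled when phi is compared with phi o S
    on Ah; since S(h) = h there, the two agree exactly. *)

Section TensorLinear.
Variable K : fieldType.
Implicit Types V W : lmodType K.

Lemma tensDl V W (a b : V) (c : W) : (a + b) ⊗ c = a ⊗ c + b ⊗ c.
Proof. by have /= := (tens_bilinear V W).1 c 1 a b; rewrite !scale1r. Qed.

Lemma tensDr V W (a : V) (b c : W) : a ⊗ (b + c) = a ⊗ b + a ⊗ c.
Proof. by have /= := (tens_bilinear V W).2 a 1 b c; rewrite !scale1r. Qed.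

Lemma tensZl V W k (a : V) (c : W) : (k *: a) ⊗ c = k *: (a ⊗ c).
Proof. exact: (bilinearZl _ _ _ (tens_bilinear V W)). Qed.

Lemma tensZr V W k (a : V) (c : W) : a ⊗ (k *: c) = k *: (a ⊗ c).
Proof. exact: (bilinearZr _ _ _ (tens_bilinear V W)). Qed.

Lemma tens0l V W (c : W) : (0 : V) ⊗ c = 0.
Proof. by rewrite -(scale0r 0) tensZl scale0r. Qed.

Lemma tens0r V W (a : V) : a ⊗ (0 : W) = 0.
Proof. by rewrite -(scale0r 0) tensZr scale0r. Qed.

Lemma tensor_ind V W (P : V ⊗ W -> Prop) :
  (forall v w, P (v ⊗ w)) -> (forall x y, P x -> P y -> P (x + y)) ->
  forall x, P x.
Proof.
move=> Pt PD x; rewrite (tensor_sum x); apply: big_ind => //.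
by rewrite -(tens0r _ 0).
Qed.

Section TensorMaps.
Variables (V W V' W' : lmodType K) (f : {linear V -> V'}) (g : {linear W -> W'}).

HB.instance Definition _ :=
  GRing.isLinear.Build K (V ⊗ W)%type (V' ⊗ W')%type _ (tmap f g)
    (tmap_linear (linearP f) (linearP g)).

Lemma tmapE v w : tmap f g (v ⊗ w) = f v ⊗ g w.
Proof. exact: tmap_tens (linearP f) (linearP g). Qed.

End TensorMaps.

HB.instance Definition _ V W U :=
  GRing.isLinear.Build K ((V ⊗ W) ⊗ U)%type (V ⊗ (W ⊗ U))%type _ (@tassoc K V W U)
    (@tassoc_linear K V W U).

Section Slices.
Variables V W : lmodType K.

HB.instance Definition _ (phi : {scalar W}) :=
  GRing.isLinear.Build K (V ⊗ W)%type V _ (@slicer K V W phi)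
    (tlift_linear (slicer_bilinear V (linearP phi))).

HB.instance Definition _ (phi : {scalar V}) :=
  GRing.isLinear.Build K (V ⊗ W)%type W _ (@slicel K V W phi)
    (tlift_linear (slicel_bilinear W (linearP phi))).

Lemma slicerE (phi : {scalar W}) (v : V) w : slicer phi (v ⊗ w) = phi w *: v.
Proof. exact: slicer_tens (linearP phi). Qed.

Lemma slicelE (phi : {scalar V}) v (w : W) : slicel phi (v ⊗ w) = phi v *: w.
Proof. exact: slicel_tens (linearP phi). Qed.

End Slices.

Lemma slice_comm V W (f : {scalar V}) (g : {scalar W}) (x : V ⊗ W) :
  f (slicer g x) = g (slicel f x).
Proof.
elim/tensor_ind: x => [v w|x y hx hy]; last by rewrite !linearD hx hy.
by rewrite slicerE slicelE !linearZ /= mulrC.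
Qed.

End TensorLinear.

(** * Separating functionals *)

Section Separation.
Variable K : fieldType.
Implicit Types V W : lmodType K.

Definition subspace V (P : V -> Prop) :=
  P 0 /\ forall k u v, P u -> P v -> P (k *: u + v).

(** By Zorn there is a maximal subspace M containing [U] and avoiding [w]. Maximality gives V = M +
    K w, and f is the coordinate along [w]. *)
Lemma separating_functional V (U : V -> Prop) (w : V) :
  subspace U -> ~ U w ->
  exists2 f : {scalar V}, forall u, U u -> f u = 0 & f w = 1.
Proof.
move=> [U0 UD] Uw.
pose avoids (M : set V) :=
  [/\ forall u, U u -> M u, forall k u v, M u -> M v -> M (k *: u + v) & ~ M w].
pose P (M : set V) := M = set0 \/ avoids M.
have [F FP Ftot|M [PM Mmax]] := @Zorn_bigcup V P.
  have [[M0 FM0 aM0]|none] := pselect (exists2 M, F M & avoids M); last first.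
    left; apply/seteqP; split=> // x [M FM Mx].
    by case: (FP _ FM) => [M0|aM]; [rewrite M0 in Mx|apply: none; exists M].
  have aF M x : F M -> M x -> avoids M.
    by move=> FM Mx; case: (FP _ FM) => // M0'; rewrite M0' in Mx.
  right; split.
  - by move=> u Uu; exists M0 => //; case: aM0 => + _ _; apply.
  - move=> k u v [M FM Mu] [N FN Nv].
    have [MN|NM] := Ftot _ _ FM FN.
    + by exists N => //; have [_ + _] := aF _ _ FN Nv; apply=> //; apply: MN.
    + by exists M => //; have [_ + _] := aF _ _ FM Mu; apply=> //; apply: NM.
  - by move=> [M FM Mw]; have [_ _] := aF _ _ FM Mw; apply.
have aU : avoids U by split.
have {PM} [MU MD Mw] : avoids M.
  case: PM => // M0; exfalso; apply: (Mmax U); last by right.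
  by rewrite M0; split=> // /(_ 0 U0).
have M0 := MU _ U0.
(* If [v] were outside M + K w, then M + K v would still avoid [w] and contradict maximality. *)
have ex v : exists k, M (v - k *: w).
  apply: contrapT => nex.
  have Mv : ~ M v by move=> Mv; apply: nex; exists 0; rewrite scale0r subr0.
  apply: (Mmax (fun x => exists k, M (x - k *: v))).
    split=> [x Mx|sub]; first by exists 0; rewrite scale0r subr0.
    by apply: Mv; apply: sub; exists 1; rewrite scale1r subrr.
  right; split.
  - by move=> u /MU Mu; exists 0; rewrite scale0r subr0.
  - move=> k x y [a Ma] [b Mb]; exists (k * a + b).
    have -> : k *: x + y - (k * a + b) *: v = k *: (x - a *: v) + (y - b *: v).
      by rewrite scalerDl -scalerA scalerBr opprD addrACA.
    exact: MD.
  - move=> [k Mk]; have [k0|k0] := eqVneq k 0.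
      by apply: Mw; rewrite k0 scale0r subr0 in Mk.
    apply: nex; exists k^-1.
    have -> : v - k^-1 *: w = - k^-1 *: (w - k *: v) + 0.
      by rewrite addr0 scalerBr !scaleNr scalerA mulVf // scale1r opprK addrC.
    exact: MD.
have [f fM] := boolp.choice ex.
have fE v k : M (v - k *: w) -> f v = k.
  move=> Mk; apply/eqP; rewrite -subr_eq0; apply/negP => /negP nz; apply: Mw.
  have -> : w = (f v - k)^-1 *: ((v - k *: w) - (v - f v *: w)) + 0.
    have -> : (v - k *: w) - (v - f v *: w) = (f v - k) *: w.
      by rewrite scalerBl opprB addrC -addrA addKr.
    by rewrite addr0 scalerA mulVf // scale1r.
  apply: (MD) => //.
  have -> : (v - k *: w) - (v - f v *: w) = -1 *: (v - f v *: w) + (v - k *: w).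
    by rewrite scaleN1r addrC.
  exact: MD.
have flin : scalar f.
  move=> k x y; apply: fE.
  have -> : k *: x + y - (k * f x + f y) *: w = k *: (x - f x *: w) + (y - f y *: w).
    by rewrite scalerDl -scalerA scalerBr opprD addrACA.
  exact: MD.
pose g : {scalar V} := HB.pack f (GRing.isLinear.Build K V K *%R f flin).
exists g => [u Uu|] /=; apply: fE; first by rewrite scale0r subr0; apply: MU.
by rewrite scale1r subrr.
Qed.

(* If no functional vanishes on the other first components but not on the last
   one, then the latter is a combination of the others, and the sum can be
   shortened; otherwise that functional shows that the last second component
   lies in J. *)
Lemma slices_in_subspace V W (J : W -> Prop) (x : V ⊗ W) :
  subspace J -> (forall f : {scalar V}, J (slicel f x)) ->
  exists n (v : nat -> V) (w : nat -> W),
    (forall i, J (w i)) /\ x = \sum_(i < n) v i ⊗ w i.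
Proof.
move=> sJ; have [J0 JD] := sJ.
have [n [v [w ->]]] : exists n (v : nat -> V) (w : nat -> W),
    x = \sum_(i < n) v i ⊗ w i.
  exists (size (repr x)), (fun i => (nth 0 (repr x) i).1),
    (fun i => (nth 0 (repr x) i).2).
  by rewrite {1}(tensor_sum x) (big_nth 0) big_mkord.
elim: n v w => [|n IH] v w Jx.
  exists 0, (fun=> 0), (fun=> 0); split=> //; by rewrite !big_ord0.
pose U u := exists c : nat -> K, u = \sum_(i < n) c i *: v i.
have sU : subspace U.
  split; first by exists (fun=> 0); rewrite big1 // => i _; rewrite scale0r.
  move=> k _ _ [c ->] [d ->]; exists (fun i => k * c i + d i).
  rewrite scaler_sumr -big_split /=; apply: eq_bigr => i _.
  by rewrite scalerDl scalerA.
have [[c vE]|nU] := pselect (U (v n)).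
  have xE : \sum_(i < n.+1) v i ⊗ w i = \sum_(i < n) v i ⊗ (w i + c i *: w n).
    rewrite big_ord_recr /= vE.
    have -> : (\sum_(i < n) c i *: v i) ⊗ w n = \sum_(i < n) v i ⊗ (c i *: w n).
      elim/big_ind2: _ => [|a b a' b' <- <-|i _]; first exact: tens0l.
        exact: tensDl.
      by rewrite tensZl tensZr.
    rewrite -big_split; apply: eq_bigr => i _; by rewrite tensDr.
  rewrite xE in Jx *; exact: (IH v (fun i => w i + c i *: w n) Jx).
have [f f0 f1] := separating_functional sU nU.
have fv i : (i < n)%N -> f (v i) = 0.
  move=> lin; apply: f0; exists (fun j => (j == i)%:R).
  rewrite (bigD1 (Ordinal lin)) //= eqxx scale1r big1 ?addr0 // => j.
  by rewrite -val_eqE => /negPf /= ->; rewrite scale0r.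
have Jn : J (w n).
  have := Jx f; rewrite linear_sum big_ord_recr /= slicelE f1 scale1r.
  by rewrite big1 ?add0r // => i _; rewrite slicelE fv // scale0r.
(* Dropping the last term keeps the hypothesis: its slices are multiples of [w n], which lies in
   [J]. *)
have [|m [v' [w' [Jw' E]]]] := IH v w.
  move=> g; have := Jx g; rewrite !linear_sum big_ord_recr /= slicelE => Jg.
  have -> : \sum_(i < n) slicel g (v i ⊗ w i) =
     - g (v n) *: w n + (\sum_(i < n) slicel g (v i ⊗ w i) + g (v n) *: w n).
    by rewrite scaleNr addrC addrK.
  exact: JD.
exists m.+1, (fun i => if (i < m)%N then v' i else v n),
  (fun i => if (i < m)%N then w' i else w n); split.
  by move=> i; case: ifP.
rewrite !big_ord_recr /= ltnn E; congr (_ + _).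
by apply: eq_bigr => i _; rewrite ltn_ord.
Qed.

Lemma slicel_inj V W (x : V ⊗ W) : (forall f : {scalar V}, slicel f x = 0) -> x = 0.
Proof.
move=> x0; have [|//|n [v [w [w0 ->]]]] := @slices_in_subspace V W (eq 0) x.
- by split=> // k u v <- <-; rewrite scaler0 add0r.
- by rewrite big1 // => i _; rewrite -w0 tens0r.
Qed.

Lemma functional_inj V (v : V) : (forall f : {scalar V}, f v = 0) -> v = 0.
Proof.
move=> v0; apply: contrapT => nv.
have [||f _ f1] := @separating_functional V (eq 0) v.
- by split=> // k u w <- <-; rewrite scaler0 add0r.
- by move=> e; apply: nv.
by move: f1; rewrite v0 => /esym/eqP; rewrite oner_eq0.
Qed.

End Separation.

(** * Star algebras and multipliers *)

Section StarAlgebraMaps.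
Variable K : numClosedFieldType.
Implicit Types A B : starAlgType K.

Lemma smulDl A (a b c : A) : (a + b) ** c = a ** c + b ** c.
Proof. by have := smulPl c 1 a b; rewrite !scale1r. Qed.

Lemma smulDr A (a b c : A) : a ** (b + c) = a ** b + a ** c.
Proof. by have := smulPr a 1 b c; rewrite !scale1r. Qed.

Lemma smulZl A k (a c : A) : (k *: a) ** c = k *: (a ** c).
Proof. by have := smulPl c k a 0; rewrite !addr0 smul0l addr0. Qed.

Lemma smulZr A k (a c : A) : a ** (k *: c) = k *: (a ** c).
Proof. by have := smulPr a k c 0; rewrite !addr0 smul0r addr0. Qed.

Lemma starD A (a b : A) : star (a + b) = star a + star b.
Proof. by have := starP 1 a b; rewrite conjC1 !scale1r. Qed.

Lemma smul_tens A B (a c : A) (b d : B) : (a ⊗ b) ** (c ⊗ d) = (a ** c) ⊗ (b ** d).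
Proof. exact: tmul_tens. Qed.

Lemma star_tens A B (a : A) (b : B) : star (a ⊗ b) = star a ⊗ star b.
Proof. exact: tstar_tens. Qed.

Definition lmul A (a b : A) := a ** b.
Definition rmul A (a b : A) := b ** a.

HB.instance Definition _ A (a : A) :=
  GRing.isLinear.Build K A A _ (lmul a) (smulPr a).
HB.instance Definition _ A (a : A) :=
  GRing.isLinear.Build K A A _ (rmul a) (smulPl a).

Definition mulm A : A ⊗ A -> A := tlift smul.

HB.instance Definition _ A :=
  GRing.isLinear.Build K (A ⊗ A)%type A _ (@mulm A)
    (tlift_linear (@smul_bilinear K A)).

Lemma mulmE A (a b : A) : mulm (a ⊗ b) = a ** b.
Proof. exact: tlift_tens (@smul_bilinear K A). Qed.

(** Functionals reduce the claim to each factor. A factor d multiplying the second leg is absorbed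
    into the functional g; after exchanging the two slices, non-degeneracy of A applies to the first
    leg. *)
Lemma nondegenerate_tensor A B :
  Defs.nondegenerate A -> Defs.nondegenerate B -> Defs.nondegenerate (A ⊗ B)%type.
Proof.
move=> [Al Ar] [Bl Br]; split=> x x0; apply: slicel_inj => f.
  apply: Bl => d; apply: functional_inj => g.
  pose gd : {scalar B} := g \o rmul d.
  have -> : g (slicel f x ** d) = gd (slicel f x) by [].
  rewrite -slice_comm.
  suff -> : slicer gd x = 0 by rewrite linear0.
  apply: Al => c.
  have -> : slicer gd x ** c = slicer g (x ** (c ⊗ d)).
    elim/tensor_ind: x {x0} => [a b|y z hy hz].
      by rewrite slicerE smul_tens slicerE smulZl.
    by rewrite linearD !smulDl linearD hy hz.
  by rewrite x0 linear0.
apply: Br => d; apply: functional_inj => g.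
pose gd : {scalar B} := g \o lmul d.
have -> : g (d ** slicel f x) = gd (slicel f x) by [].
rewrite -slice_comm.
suff -> : slicer gd x = 0 by rewrite linear0.
apply: Ar => c.
have -> : c ** slicer gd x = slicer g ((c ⊗ d) ** x).
  elim/tensor_ind: x {x0} => [a b|y z hy hz].
    by rewrite slicerE smul_tens slicerE smulZr.
  by rewrite linearD !smulDr linearD hy hz.
by rewrite x0 linear0.
Qed.

Lemma mlD A (m : multiplier A) a b : ml m (a + b) = ml m a + ml m b.
Proof. by have [+ _ _ _ _] := multiplierP m => /(_ 1 a b); rewrite !scale1r. Qed.
Lemma mrD A (m : multiplier A) a b : mr m (a + b) = mr m a + mr m b.
Proof. by have [_ + _ _ _] := multiplierP m => /(_ 1 a b); rewrite !scale1r. Qed.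

HB.instance Definition _ A (m : multiplier A) :=
  GRing.isLinear.Build K A A _ (ml m) (let: And5 h _ _ _ _ := multiplierP m in h).
HB.instance Definition _ A (m : multiplier A) :=
  GRing.isLinear.Build K A A _ (mr m) (let: And5 _ h _ _ _ := multiplierP m in h).

Lemma ml_smul A (m n : multiplier A) a : ml (m ** n) a = ml m (ml n a).
Proof. by []. Qed.
Lemma mr_smul A (m n : multiplier A) a : mr (m ** n) a = mr n (mr m a).
Proof. by []. Qed.
Lemma ml_mulr A (m : multiplier A) a b : ml m (a ** b) = ml m a ** b.
Proof. by have [_ _ + _ _] := multiplierP m. Qed.
Lemma mr_mull A (m : multiplier A) a b : mr m (a ** b) = a ** mr m b.
Proof. by have [_ _ _ + _] := multiplierP m. Qed.
Lemma ml_mr A (m : multiplier A) a b : a ** ml m b = mr m a ** b.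
Proof. by have [_ _ _ _ +] := multiplierP m. Qed.

Lemma mul1m A (m : multiplier A) : mone A ** m = m.
Proof. exact: multiplier_eq. Qed.
Lemma mulm1 A (m : multiplier A) : m ** mone A = m.
Proof. exact: multiplier_eq. Qed.
Lemma star_mone A : star (mone A) = mone A.
Proof. by apply: multiplier_eq => a; rewrite /= ?ml_star ?mr_star starK. Qed.

Lemma mlE A (a b : A) : ml (memb a) b = a ** b.
Proof. by []. Qed.
Lemma mrE A (a b : A) : mr (memb a) b = b ** a.
Proof. by []. Qed.

Lemma membM A (a b : A) : memb (a ** b) = memb a ** memb b.
Proof. by apply: multiplier_eq => c; rewrite ?ml_smul ?mr_smul ?mlE ?mrE ?smulA. Qed.
Lemma memb_star A (a : A) : memb (star a) = star (memb a).
Proof.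
by apply: multiplier_eq => c; rewrite /= ?ml_star ?mr_star ?mlE ?mrE starM starK.
Qed.

Lemma memb_linear A : linear (@memb K A).
Proof.
by move=> k a b; apply: multiplier_eq => c; rewrite ?mlP ?mrP ?mlE ?mrE;
  [apply: smulPl|apply: smulPr].
Qed.
HB.instance Definition _ A :=
  GRing.isLinear.Build K A (multiplier A) _ (@memb K A) (@memb_linear A).

(** Most identities in A ⊗ A below are proved through this injectivity: as multipliers, T1 and T2
    become honest products with the values of the comultiplication. *)
Lemma memb_inj A : Defs.nondegenerate A -> injective (@memb K A).
Proof.
move=> [Al _] a b e; apply/eqP; rewrite -subr_eq0; apply/eqP/Al => c.
rewrite smulDl -scaleN1r smulZl scaleN1r; apply/eqP; rewrite subr_eq0.
by rewrite -mlE e.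
Qed.

Lemma multiplier_eql A (m n : multiplier A) :
  Defs.nondegenerate A -> ml m =1 ml n -> m = n.
Proof.
move=> [Al _] e; apply: multiplier_eq => // a.
apply/eqP; rewrite -subr_eq0; apply/eqP/Al => c.
by rewrite smulDl -scaleN1r smulZl scaleN1r -!ml_mr e subrr.
Qed.

Lemma ml_memb A (m : multiplier A) a : m ** memb a = memb (ml m a).
Proof. by apply: multiplier_eq => b; rewrite ?ml_smul ?mr_smul ?mlE ?mrE ?ml_mulr -?ml_mr. Qed.
Lemma mr_memb A (m : multiplier A) a : memb a ** m = memb (mr m a).
Proof. by apply: multiplier_eq => b; rewrite ?ml_smul ?mr_smul ?mlE ?mrE ?mr_mull ?ml_mr. Qed.

Lemma ml_mtens A B (m : multiplier A) (n : multiplier B) a b :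
  ml (mtens m n) (a ⊗ b) = ml m a ⊗ ml n b.
Proof. exact: tmapE. Qed.
Lemma mr_mtens A B (m : multiplier A) (n : multiplier B) a b :
  mr (mtens m n) (a ⊗ b) = mr m a ⊗ mr n b.
Proof. exact: tmapE. Qed.

Lemma mtensor_eq A B (m n : multiplier (A ⊗ B)) :
  (forall a b, ml m (a ⊗ b) = ml n (a ⊗ b)) ->
  (forall a b, mr m (a ⊗ b) = mr n (a ⊗ b)) -> m = n.
Proof.
by move=> el er; apply: multiplier_eq; elim/tensor_ind => // x y hx hy;
  rewrite ?mlD ?mrD hx hy.
Qed.

Lemma mtensM A B (m m' : multiplier A) (n n' : multiplier B) :
  mtens m n ** mtens m' n' = mtens (m ** m') (n ** n').
Proof.
by apply: mtensor_eq => a b; rewrite ?ml_smul ?mr_smul ?ml_mtens ?mr_mtens.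
Qed.

Lemma memb_tens A B (a : A) (b : B) : memb (a ⊗ b) = mtens (memb a) (memb b).
Proof.
by apply: mtensor_eq => c d; rewrite ?ml_mtens ?mr_mtens ?mlE ?mrE smul_tens.
Qed.

Lemma star_mtens A B (m : multiplier A) (n : multiplier B) :
  star (mtens m n) = mtens (star m) (star n).
Proof.
apply: mtensor_eq => a b; rewrite ?ml_mtens ?mr_mtens ?ml_star ?mr_star star_tens
  ?ml_mtens ?mr_mtens ?ml_star ?mr_star star_tens //.
Qed.

Lemma mtensDr A B (m : multiplier A) (n n' : multiplier B) :
  mtens m (n + n') = mtens m n + mtens m n'.
Proof.
apply: mtensor_eq => a b.
  by rewrite [RHS](_ : _ = ml (mtens m n) (a ⊗ b) + ml (mtens m n') (a ⊗ b)) //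
    !ml_mtens -tensDr.
by rewrite [RHS](_ : _ = mr (mtens m n) (a ⊗ b) + mr (mtens m n') (a ⊗ b)) //
  !mr_mtens -tensDr.
Qed.
Lemma mtensDl A B (m m' : multiplier A) (n : multiplier B) :
  mtens (m + m') n = mtens m n + mtens m' n.
Proof.
apply: mtensor_eq => a b.
  by rewrite [RHS](_ : _ = ml (mtens m n) (a ⊗ b) + ml (mtens m' n) (a ⊗ b)) //
    !ml_mtens -tensDl.
by rewrite [RHS](_ : _ = mr (mtens m n) (a ⊗ b) + mr (mtens m' n) (a ⊗ b)) //
  !mr_mtens -tensDl.
Qed.
Lemma mtensZl A B k (m : multiplier A) (n : multiplier B) :
  mtens (k *: m) n = k *: mtens m n.
Proof.
apply: mtensor_eq => a b.
  by rewrite [RHS](_ : _ = k *: ml (mtens m n) (a ⊗ b)) // !ml_mtens -tensZl.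
by rewrite [RHS](_ : _ = k *: mr (mtens m n) (a ⊗ b)) // !mr_mtens -tensZl.
Qed.
Lemma mtensZr A B k (m : multiplier A) (n : multiplier B) :
  mtens m (k *: n) = k *: mtens m n.
Proof.
apply: mtensor_eq => a b.
  by rewrite [RHS](_ : _ = k *: ml (mtens m n) (a ⊗ b)) // !ml_mtens -tensZr.
by rewrite [RHS](_ : _ = k *: mr (mtens m n) (a ⊗ b)) // !mr_mtens -tensZr.
Qed.

Lemma memb_rmul1 A B (x : A ⊗ B) (c : A) :
  memb x ** mtens (memb c) (mone B) = memb (tmap (rmul c) idfun x).
Proof. by rewrite mr_memb. Qed.
Lemma memb_rmul2 A B (x : A ⊗ B) (c : B) :
  memb x ** mtens (mone A) (memb c) = memb (tmap idfun (rmul c) x).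
Proof. by rewrite mr_memb. Qed.
Lemma memb_lmul1 A B (x : A ⊗ B) (c : A) :
  mtens (memb c) (mone B) ** memb x = memb (tmap (lmul c) idfun x).
Proof. by rewrite ml_memb. Qed.
Lemma memb_lmul2 A B (x : A ⊗ B) (c : B) :
  mtens (mone A) (memb c) ** memb x = memb (tmap idfun (lmul c) x).
Proof. by rewrite ml_memb. Qed.

End StarAlgebraMaps.

Lemma slicel_map (K : fieldType) (V W V' W' : lmodType K) (f : {linear V -> V'})
    (g : {linear W -> W'}) (phi : {scalar V'}) (x : V ⊗ W) :
  slicel phi (tmap f g x) = g (slicel (phi \o f) x).
Proof.
elim/tensor_ind: x => [v w|x y hx hy]; last by rewrite !linearD /= hx hy.
by rewrite tmapE !slicelE linearZ.
Qed.

Lemma slicer_map (K : fieldType) (V W V' W' : lmodType K) (f : {linear V -> V'})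
    (g : {linear W -> W'}) (phi : {scalar W'}) (x : V ⊗ W) :
  slicer phi (tmap f g x) = f (slicer (phi \o g) x).
Proof.
elim/tensor_ind: x => [v w|x y hx hy]; last by rewrite !linearD /= hx hy.
by rewrite tmapE !slicerE linearZ.
Qed.

(** * Convolution and antipodes of unital bialgebras *)

Section Convolution.
Variables (K : numClosedFieldType) (B : starAlgType K).
Variable (D : {linear B -> (B ⊗ B)%type}).
Implicit Types C : starAlgType K.

Definition conv C (f g : B -> C) (a : B) : C := mulm (tmap f g (D a)).

Lemma conv_linear C (f g : {linear B -> C}) : linear (conv f g).
Proof. by move=> k a b; rewrite /conv !linearP. Qed.
HB.instance Definition _ C (f g : {linear B -> C}) :=
  GRing.isLinear.Build K B C _ (conv f g) (conv_linear f g).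

Hypothesis coassD : forall a, tassoc (tmap D idfun (D a)) = tmap idfun D (D a).

Lemma convA C (f g k : {linear B -> C}) a :
  conv f (conv g k) a = conv (conv f g) k a.
Proof.
have l x : mulm (tmap f (conv g k) x) =
    mulm (tmap idfun (@mulm K C) (tmap f (tmap g k) (tmap idfun D x))).
  elim/tensor_ind: x => [b c|x y hx hy]; last by rewrite !linearD /= hx hy.
  by rewrite !tmapE.
have r x : mulm (tmap (conv f g) k x) =
    mulm (tmap (@mulm K C) idfun (tmap (tmap f g) k (tmap D idfun x))).
  elim/tensor_ind: x => [b c|x y hx hy]; last by rewrite !linearD /= hx hy.
  by rewrite !tmapE.
rewrite /conv -/(conv _ _) l r -coassD.
move: (tmap D _ _); elim/tensor_ind => [x c|x y hx hy]; last by rewrite !linearD /= hx hy.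
elim/tensor_ind: x => [b d|x y hx hy]; last by rewrite tensDl !linearD /= hx hy.
by rewrite tassoc_tens !tmapE /= !tmapE /= !mulmE smulA.
Qed.

Lemma conv_hom C C' (j : {linear C -> C'}) (f g : {linear B -> C}) a :
  {morph j : b c / b ** c} -> conv (j \o f) (j \o g) a = j (conv f g a).
Proof.
move=> jM; rewrite /conv; move: (D a).
elim/tensor_ind => [b c|x y hx hy]; last by rewrite !linearD /= hx hy.
by rewrite !tmapE /= !mulmE jM.
Qed.

Variable eps : {scalar B}.
Hypothesis epsl : forall a, slicel eps (D a) = a.
Hypothesis epsr : forall a, slicer eps (D a) = a.

(** A functional made C-valued so that it can be convolved. For the counit and an identity [u] it is
    the unit of convolution; other functionals occur when right invariance is proved. *)
Definition conv_one C (u : C) (phi : B -> K) (a : B) : C := phi a *: u.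

Lemma conv_one_linear C (u : C) (phi : {scalar B}) : linear (conv_one u phi).
Proof. by move=> k a b; rewrite /conv_one linearP scalerDl scalerA. Qed.
HB.instance Definition _ C (u : C) (phi : {scalar B}) :=
  GRing.isLinear.Build K B C _ (conv_one u phi) (conv_one_linear u phi).

Lemma conv_onel C (u : C) (phi : {scalar B}) (f : {linear B -> C}) a :
  is_identity u -> conv (conv_one u phi) f a = f (slicel phi (D a)).
Proof.
move=> u1; rewrite /conv; move: (D a).
elim/tensor_ind => [b c|x y hx hy]; last by rewrite !linearD /= hx hy.
by rewrite tmapE /= mulmE slicelE /conv_one smulZl linearZ (u1 _).1.
Qed.

Lemma conv_oner C (u : C) (phi : {scalar B}) (f : {linear B -> C}) a :
  is_identity u -> conv f (conv_one u phi) a = f (slicer phi (D a)).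
Proof.
move=> u1; rewrite /conv; move: (D a).
elim/tensor_ind => [b c|x y hx hy]; last by rewrite !linearD /= hx hy.
by rewrite tmapE /= mulmE slicerE /conv_one smulZr linearZ (u1 _).2.
Qed.

Lemma eq_conv C (f f' g g' : B -> C) : f =1 f' -> g =1 g' -> conv f g =1 conv f' g'.
Proof. by move=> /funext -> /funext ->. Qed.

(** * Unital bialgebras whose Galois map is bijective: antipode and invariant functionals *)

Section Unital.
Variable one : B.
Hypothesis one_id : is_identity one.
Hypothesis DM : {morph D : a b / a ** b}.
Hypothesis D1 : D one = one ⊗ one.
Hypothesis eps1 : eps one = 1.

(** The canonical map a ⊗ b |-> D(a)(1 ⊗ b), the unital counterpart of T1, composed from linear maps
    so that linearity is immediate. *)
Definition galois (x : B ⊗ B) : B ⊗ B :=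
  tmap idfun (@mulm K B) (tassoc (tmap D idfun x)).

Lemma galois_linear : linear galois.
Proof. by move=> k x y; rewrite /galois !linearP. Qed.
HB.instance Definition _ :=
  GRing.isLinear.Build K (B ⊗ B)%type (B ⊗ B)%type _ galois galois_linear.

Lemma galoisE a b : galois (a ⊗ b) = tmap idfun (rmul b) (D a).
Proof.
rewrite /galois tmapE; move: (D a).
elim/tensor_ind => [c d|x y hx hy]; last by rewrite tensDl !linearD /= hx hy.
by rewrite tassoc_tens !tmapE /= mulmE.
Qed.

Lemma slicel_galois x : slicel eps (galois x) = mulm x.
Proof.
elim/tensor_ind: x => [a b|x y hx hy]; last by rewrite !linearD /= hx hy.
by rewrite galoisE slicel_map epsl mulmE.
Qed.

Lemma galois_rmul b x : galois (tmap idfun (rmul b) x) = tmap idfun (rmul b) (galois x).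
Proof.
elim/tensor_ind: x => [a c|x y hx hy]; last by rewrite !linearD /= hx hy.
rewrite tmapE !galoisE; move: (D a).
elim/tensor_ind => [d e|x y hx hy]; last by rewrite !linearD /= hx hy.
by rewrite !tmapE /= /rmul smulA.
Qed.

(** Coassociativity in a form that lets the inverse [G] be moved past D ⊗ iota. *)
Lemma galois_pentagon x :
  tmap idfun galois (tassoc (tmap D idfun x)) = tassoc (tmap D idfun (galois x)).
Proof.
elim/tensor_ind: x => [a b|x y hx hy]; last by rewrite !linearD /= hx hy.
rewrite galoisE tmapE.
have -> y : tmap idfun galois (tassoc (y ⊗ b)) =
    tmap idfun (tmap idfun (rmul b)) (tmap idfun D y).
  elim/tensor_ind: y => [c d|x y hx hy]; last by rewrite tensDl !linearD /= hx hy.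
  by rewrite tassoc_tens !tmapE /= galoisE.
rewrite -coassD; move: (D a).
elim/tensor_ind => [c d|x y hx hy]; last by rewrite !linearD /= hx hy.
rewrite !tmapE /=; move: (D c) => z.
elim/tensor_ind: z => [e f|x y hx hy]; last by rewrite !tensDl !linearD /= hx hy.
by rewrite !tassoc_tens !tmapE /= tmapE.
Qed.

Variable G : {linear (B ⊗ B)%type -> (B ⊗ B)%type}.
Hypothesis galoisK : cancel galois G.
Hypothesis GK : cancel G galois.

(** The expected inverse is G(a ⊗ 1) = a_1 ⊗ S(a_2), so eps on the first leg extracts S(a). *)
Definition antipode (a : B) : B := slicel eps (G (a ⊗ one)).

Lemma antipode_linear : linear antipode.
Proof. by move=> k a b; rewrite /antipode tensDl tensZl !linearP. Qed.
HB.instance Definition _ :=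
  GRing.isLinear.Build K B B _ antipode antipode_linear.

Lemma slicel_galois_inv a b : slicel eps (G (a ⊗ b)) = antipode a ** b.
Proof.
have -> : a ⊗ b = tmap idfun (rmul b) (galois (G (a ⊗ one))).
  by rewrite GK tmapE /= /rmul (one_id _).1.
by rewrite -galois_rmul galoisK slicel_map.
Qed.

Lemma conv_antipodel a : conv antipode idfun a = conv_one one eps a.
Proof.
have -> : conv antipode idfun a = slicel eps (G (D a)).
  rewrite /conv; move: (D a).
  elim/tensor_ind => [c d|x y hx hy]; last by rewrite !linearD /= hx hy.
  by rewrite tmapE /= mulmE slicel_galois_inv.
have -> : D a = galois (a ⊗ one).
  rewrite galoisE; move: (D a).
  elim/tensor_ind => [c d|x y hx hy]; last by rewrite !linearD /= -?hx -?hy.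
  by rewrite tmapE /= /rmul (one_id _).2.
by rewrite galoisK slicelE.
Qed.

(** Apply eps to the middle leg of the pentagon relation for G(a ⊗ 1). On one side the counit undoes
    D; on the other it turns [G] into the antipode by definition. *)
Lemma galois_inv_antipode a : G (a ⊗ one) = tmap idfun antipode (D a).
Proof.
have E : tassoc (tmap D idfun (G (a ⊗ one))) = tmap idfun G (tassoc (D a ⊗ one)).
  have -> : tassoc (D a ⊗ one) = tassoc (tmap D idfun (galois (G (a ⊗ one)))).
    by rewrite GK tmapE.
  rewrite -galois_pentagon; move: (tassoc _).
  elim/tensor_ind => [c d|x y hx hy]; last by rewrite !linearD /= -?hx -?hy.
  by rewrite !tmapE /= galoisK.
have -> : tmap idfun antipode (D a) =
    tmap idfun (slicel eps) (tmap idfun G (tassoc (D a ⊗ one))).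
  move: (D a); elim/tensor_ind => [c d|x y hx hy]; last by rewrite tensDl !linearD /= hx hy.
  by rewrite tassoc_tens !tmapE.
rewrite -E; move: (G _).
elim/tensor_ind => [c d|x y hx hy]; last by rewrite !linearD /= -?hx -?hy.
rewrite tmapE /= -{1}(epsr c); move: (D c) => z.
elim/tensor_ind: z => [e f|x y hx hy]; last by rewrite ?linearD !tensDl !linearD /= hx hy.
by rewrite tassoc_tens tmapE /= slicelE slicerE tensZl tensZr.
Qed.

Lemma conv_antipoder a : conv idfun antipode a = conv_one one eps a.
Proof. by rewrite /conv -galois_inv_antipode -slicel_galois GK slicelE. Qed.

Lemma antipode1 : antipode one = one.
Proof.
have := conv_antipoder one.
by rewrite /conv D1 tmapE /= mulmE (one_id _).1 /conv_one eps1 scale1r.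
Qed.

Definition tinl (b : B) : B ⊗ B := b ⊗ one.
Definition tinr (b : B) : B ⊗ B := one ⊗ b.
Lemma tinl_linear : linear tinl.
Proof. by move=> k a b; rewrite /tinl tensDl tensZl. Qed.
Lemma tinr_linear : linear tinr.
Proof. by move=> k a b; rewrite /tinr tensDr tensZr. Qed.
HB.instance Definition _ := GRing.isLinear.Build K B (B ⊗ B)%type _ tinl tinl_linear.
HB.instance Definition _ := GRing.isLinear.Build K B (B ⊗ B)%type _ tinr tinr_linear.

Lemma tinlM : {morph tinl : a b / a ** b}.
Proof. by move=> a b; rewrite /tinl smul_tens (one_id _).1. Qed.
Lemma tinrM : {morph tinr : a b / a ** b}.
Proof. by move=> a b; rewrite /tinr smul_tens (one_id _).1. Qed.

Lemma tensor_id : is_identity (one ⊗ one).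
Proof.
elim/tensor_ind => [a b|x y [xl xr] [yl yr]].
  by rewrite !smul_tens !(one_id _).1 !(one_id _).2.
by rewrite smulDl smulDr xl xr yl yr.
Qed.

Lemma conv_tin a : conv tinl tinr a = D a.
Proof.
rewrite /conv; move: (D a).
elim/tensor_ind => [b c|x y hx hy]; last by rewrite !linearD /= hx hy.
by rewrite tmapE /= mulmE smul_tens (one_id _).1 (one_id _).2.
Qed.

Lemma conv_one_hom (C : starAlgType K) (j : {linear B -> C}) a :
  j (conv_one one eps a) = conv_one (j one) eps a.
Proof. by rewrite /conv_one linearZ. Qed.

Lemma conv_inl_antipode a : conv tinl (tinl \o antipode) a = conv_one (one ⊗ one) eps a.
Proof.
have := conv_hom idfun antipode a tinlM; rewrite conv_antipoder conv_one_hom => <-.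
exact: eq_conv.
Qed.
Lemma conv_inr_antipode a : conv tinr (tinr \o antipode) a = conv_one (one ⊗ one) eps a.
Proof.
have := conv_hom idfun antipode a tinrM; rewrite conv_antipoder conv_one_hom => <-.
exact: eq_conv.
Qed.

(* Both sides are convolution inverses of D. *)
Lemma antipode_anticomult a :
  D (antipode a) = conv (tinr \o antipode) (tinl \o antipode) a.
Proof.
set Y := conv _ _.
have DSD b : conv (D \o antipode) D b = conv_one (one ⊗ one) eps b.
  have := conv_hom antipode idfun b DM; rewrite conv_antipodel conv_one_hom D1 => <-.
  exact: eq_conv.
have DY b : conv D Y b = conv_one (one ⊗ one) eps b.
  (* D is the convolution of the two embeddings, so D convolved with Y is a product of four factors
     that collapses from the inside out. *)
  have -> : conv D Y b = conv (conv tinl tinr) Y b.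
    by apply: eq_conv => // c; rewrite conv_tin.
  rewrite -convA.
  have -> : conv tinl (conv tinr Y) b = conv tinl (tinl \o antipode) b.
    apply: eq_conv => // c; rewrite convA.
    have -> : conv (conv tinr (tinr \o antipode)) (tinl \o antipode) c =
       conv (conv_one (one ⊗ one) eps) (tinl \o antipode) c.
      by apply: eq_conv => // d; rewrite conv_inr_antipode.
    by rewrite conv_onel ?epsl //; apply: tensor_id.
  by rewrite conv_inl_antipode.
transitivity (conv (D \o antipode) (conv_one (one ⊗ one) eps) a).
  by rewrite conv_oner ?epsr //; apply: tensor_id.
transitivity (conv (D \o antipode) (conv D Y) a).
  by apply: eq_conv => // b; rewrite DY.
rewrite convA.
transitivity (conv (conv_one (one ⊗ one) eps) Y a); first exact: eq_conv.
by rewrite conv_onel ?epsl //; apply: tensor_id.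
Qed.

(** For g = phi o S, left invariance at S(a) and anticomultiplicativity of S read g(a_1)S(a_2) =
    g(a)1. Convolving on the right with the identity then cancels S through S(a_1)a_2 = eps(a)1, so
    S is never inverted. *)
Lemma left_integral_right (phi : {scalar B}) :
  (forall a, slicer phi (D a) = phi a *: one) -> phi one != 0 ->
  forall a, slicel phi (D a) = phi a *: one.
Proof.
move=> phil phi1; pose g : {scalar B} := phi \o antipode.
have gS a : conv (conv_one one g) antipode a = conv_one one g a.
  rewrite conv_onel // /conv_one /= -phil antipode_anticomult /conv.
  move: (D a); elim/tensor_ind => [b c|x y hx hy]; last by rewrite !linearD /= hx hy.
  by rewrite tmapE /= mulmE smul_tens !(one_id _).1 (one_id _).2 slicelE slicerE linearZ.
have gr a : slicel g (D a) = g a *: one.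
  transitivity (conv (conv_one one g) idfun a); first by rewrite conv_onel.
  transitivity (conv (conv (conv_one one g) antipode) idfun a).
    by apply: eq_conv => // b; rewrite gS.
  rewrite -convA.
  transitivity (conv (conv_one one g) (conv_one one eps) a).
    by apply: eq_conv => // b; rewrite conv_antipodel.
  by rewrite conv_oner // epsr.
(* Evaluate g ⊗ phi on D(a) in two ways: phi(a)g(1) = g(a)phi(1), and g(1) = phi(S(1)) = phi(1). *)
have gphi a : g a = phi a.
  have := slice_comm g phi (D a); rewrite gr phil !linearZ /= antipode1.
  by move/(mulIf phi1).
by move=> a; rewrite -gphi -gr; congr tlift; apply/funext => b; apply/funext => c;
  rewrite gphi.
Qed.

Definition galois' (x : B ⊗ B) : B ⊗ B := mulm (tmap tinl D x).

(** The map a ⊗ b |-> a S(b_1) ⊗ b_2 is a left inverse, because b_1 S(b_2) ⊗ b_3 = 1 ⊗ b. *)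
Lemma galois'_inj : injective galois'.
Proof.
pose k := conv (tinl \o antipode) tinr.
pose L x := mulm (tmap tinl k x).
have LD a : L (D a) = tinr a.
  rewrite -[L _]/(conv tinl k a) convA.
  transitivity (conv (conv_one (one ⊗ one) eps) tinr a).
    by apply: eq_conv => // b; rewrite conv_inl_antipode.
  by rewrite conv_onel ?epsl //; apply: tensor_id.
have LDr x y : L (x + y) = L x + L y by rewrite /L !linearD.
have LM b x : L (tinl b ** x) = tinl b ** L x.
  elim/tensor_ind: x => [c d|x y hx hy].
    by rewrite smul_tens (one_id _).1 /L !tmapE /= !mulmE tinlM smulA.
  by rewrite smulDr !LDr smulDr hx hy.
apply: (can_inj (g := L)); elim/tensor_ind => [a b|x y hx hy].
  by rewrite /galois' tmapE /= mulmE LM LD smul_tens (one_id _).1 (one_id _).2.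
have -> : galois' (x + y) = galois' x + galois' y by rewrite /galois' !linearD.
by rewrite LDr hx hy.
Qed.

End Unital.
End Convolution.

(** * Cancellation by non-degeneracy, central multipliers and the associator *)

Section MoreTensor.
Variable K : numClosedFieldType.
Implicit Types A B C : starAlgType K.

Lemma tensor_nondeg_eq A B (x y : A ⊗ B) :
  Defs.nondegenerate (A ⊗ B)%type ->
  (forall c d, x ** (c ⊗ d) = y ** (c ⊗ d)) -> x = y.
Proof.
move=> [nd _] e; apply/eqP; rewrite -subr_eq0; apply/eqP/nd => z.
rewrite smulDl -scaleN1r smulZl scaleN1r; apply/eqP; rewrite subr_eq0; apply/eqP.
elim/tensor_ind: z => // u v hu hv; by rewrite !smulDr hu hv.
Qed.

Lemma tensor_nondeg_eqr A B (x y : A ⊗ B) :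
  Defs.nondegenerate (A ⊗ B)%type ->
  (forall c d, (c ⊗ d) ** x = (c ⊗ d) ** y) -> x = y.
Proof.
move=> [_ nd] e; apply/eqP; rewrite -subr_eq0; apply/eqP/nd => z.
rewrite smulDr -scaleN1r smulZr scaleN1r; apply/eqP; rewrite subr_eq0; apply/eqP.
elim/tensor_ind: z => // u v hu hv; by rewrite !smulDl hu hv.
Qed.

Lemma multiplier_eqr A (m n : multiplier A) :
  Defs.nondegenerate A -> mr m =1 mr n -> m = n.
Proof.
move=> [_ Ar] e; apply: multiplier_eq => // a.
apply/eqP; rewrite -subr_eq0; apply/eqP/Ar => c.
by rewrite smulDr -scaleN1r smulZr scaleN1r !ml_mr e subrr.
Qed.

Lemma ml_mr_comm A (m n : multiplier A) a :
  Defs.nondegenerate A -> ml m (mr n a) = mr n (ml m a).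
Proof.
move=> [Al _]; apply/eqP; rewrite -subr_eq0; apply/eqP/Al => c.
by rewrite smulDl -scaleN1r smulZl scaleN1r -ml_mulr -!ml_mr ml_mulr subrr.
Qed.

Lemma central_multiplier A (n m : multiplier A) :
  Defs.nondegenerate A -> ml n =1 mr n -> n ** m = m ** n.
Proof.
move=> nd e; apply: multiplier_eql => // a.
by rewrite !ml_smul !e ml_mr_comm.
Qed.

Definition tensl (V W : lmodType K) (v : V) (w : W) : V ⊗ W := v ⊗ w.
Lemma tensl_linear (V W : lmodType K) (v : V) : linear (@tensl V W v).
Proof. by move=> k a b; rewrite /tensl tensDr tensZr. Qed.
HB.instance Definition _ (V W : lmodType K) (v : V) :=
  GRing.isLinear.Build K W (V ⊗ W)%type _ (@tensl V W v) (tensl_linear v).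

Section AssocInverse.
Variables U V W : lmodType K.
Definition tassocV : U ⊗ (V ⊗ W) -> (U ⊗ V) ⊗ W :=
  tlift (fun u y => tmap (tensl u) idfun y).

Lemma tassocV_bilinear :
  bilinear_for *:%R *:%R (fun u (y : V ⊗ W) => tmap (@tensl U V u) idfun y).
Proof.
split=> [y|u] k a b /=; last by rewrite linearP.
elim/tensor_ind: y => [v w|x y hx hy].
  by rewrite !tmapE /= /tensl !tensDl !tensZl.
by rewrite !linearD /= hx hy addrACA.
Qed.
HB.instance Definition _ := GRing.isLinear.Build K (U ⊗ (V ⊗ W))%type
  ((U ⊗ V) ⊗ W)%type _ tassocV (tlift_linear tassocV_bilinear).

Lemma tassocVE u v w : tassocV (u ⊗ (v ⊗ w)) = (u ⊗ v) ⊗ w.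
Proof. by rewrite /tassocV tlift_tens ?tmapE //; apply: tassocV_bilinear. Qed.

Lemma tassocK (x : (U ⊗ V) ⊗ W) : tassocV (tassoc x) = x.
Proof.
elim/tensor_ind: x => [y w|x y hx hy]; last by rewrite !linearD /= hx hy.
elim/tensor_ind: y => [u v|x y hx hy]; last by rewrite !tensDl !linearD /= hx hy.
by rewrite tassoc_tens tassocVE.
Qed.

Lemma tassocVK (x : U ⊗ (V ⊗ W)) : tassoc (tassocV x) = x.
Proof.
elim/tensor_ind: x => [u y|x y hx hy]; last by rewrite !linearD /= hx hy.
elim/tensor_ind: y => [v w|x y hx hy]; last by rewrite !tensDr !linearD /= hx hy.
by rewrite tassocVE tassoc_tens.
Qed.
End AssocInverse.

Lemma tassocM A B C (x y : (A ⊗ B) ⊗ C) : tassoc (x ** y) = tassoc x ** tassoc y.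
Proof.
elim/tensor_ind: x => [u c|x z hx hz]; last by rewrite smulDl !linearD /= smulDl hx hz.
elim/tensor_ind: u => [a b|x z hx hz]; last first.
  by rewrite tensDl smulDl !linearD /= smulDl hx hz.
elim/tensor_ind: y => [u d|x z hx hz]; last by rewrite smulDr !linearD /= smulDr hx hz.
elim/tensor_ind: u => [e f|x z hx hz]; last first.
  by rewrite tensDl smulDr !linearD /= smulDr hx hz.
by rewrite !smul_tens !tassoc_tens !smul_tens.
Qed.

Lemma tassoc_ml A B C (m : multiplier A) (n : multiplier B) (p : multiplier C) x :
  tassoc (ml (mtens (mtens m n) p) x) = ml (mtens m (mtens n p)) (tassoc x).
Proof.
elim/tensor_ind: x => [u c|x z hx hz]; last by rewrite !(mlD, linearD) /= hx hz.
elim/tensor_ind: u => [a b|x z hx hz]; last first.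
  by rewrite tensDl !(mlD, linearD) /= hx hz.
by rewrite !ml_mtens !tassoc_tens !ml_mtens.
Qed.

Lemma mtens1 A B : mtens (mone A) (mone B) = mone (A ⊗ B)%type.
Proof. by apply: mtensor_eq => a b; rewrite ?ml_mtens ?mr_mtens. Qed.

End MoreTensor.

(** * The maps T1 and T2 *)

Section MultiplierHopf.
Variables (K : numClosedFieldType) (A : starAlgType K).
Hypothesis ndA : Defs.nondegenerate A.
Let ndAA := nondegenerate_tensor ndA ndA.
Let ndAA_A := nondegenerate_tensor ndAA ndA.
Let ndA_AA := nondegenerate_tensor ndA ndAA.

Lemma bijective_onto_tensor_linear (f : A -> A -> multiplier (A ⊗ A)) :
  bilinear_for *:%R *:%R f -> bijective_onto_tensor (tlift f) ->
  exists T G : {linear (A ⊗ A)%type -> (A ⊗ A)%type},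
    [/\ cancel T G, cancel G T & forall a b, memb (T (a ⊗ b)) = f a b].
Proof.
move=> bf [T [G TK GK] TE].
have Tlin : linear T.
  by move=> k x y; apply: (memb_inj ndAA); rewrite -TE linearP /= -!TE tlift_linear.
have Glin : linear G.
  by move=> k x y; apply: (can_inj TK); rewrite Tlin !GK.
pose T' : {linear _ -> _} := HB.pack T (GRing.isLinear.Build K _ _ _ T Tlin).
pose G' : {linear _ -> _} := HB.pack G (GRing.isLinear.Build K _ _ _ G Glin).
by exists T', G'; split=> [||a b] //=; rewrite -TE tlift_tens.
Qed.

Variable D : {linear A -> multiplier (A ⊗ A)}.
Hypothesis DM : {morph D : a b / a ** b}.

Lemma comult1_bilinear :
  bilinear_for *:%R *:%R (fun a b => D a ** mtens (mone A) (memb b)).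
Proof.
split=> [b|a] k x y; rewrite /= linearP; first exact: smulPl.
by rewrite mtensDr mtensZr smulPr.
Qed.
Lemma comult2_bilinear :
  bilinear_for *:%R *:%R (fun a b => mtens (memb a) (mone A) ** D b).
Proof.
split=> [b|a] k x y; rewrite /= linearP; last exact: smulPr.
by rewrite mtensDl mtensZl smulPl.
Qed.

Lemma comult_l_bilinear : bilinear_for *:%R *:%R
  (fun a b => mtens (D a) (memb b) : multiplier ((A ⊗ A) ⊗ A)).
Proof.
split=> [b|a] k x y; rewrite /= linearP; first by rewrite mtensDl mtensZl.
by rewrite mtensDr mtensZr.
Qed.
Lemma comult_r_bilinear : bilinear_for *:%R *:%R
  (fun a b => mtens (memb a) (D b) : multiplier (A ⊗ (A ⊗ A))).
Proof.
split=> [b|a] k x y; rewrite /= linearP; first by rewrite mtensDl mtensZl.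
by rewrite mtensDr mtensZr.
Qed.
HB.instance Definition _ := GRing.isLinear.Build K _ _ _ (comult_l D)
  (tlift_linear comult_l_bilinear).
HB.instance Definition _ := GRing.isLinear.Build K _ _ _ (comult_r D)
  (tlift_linear comult_r_bilinear).

Lemma comult_lE a b : comult_l D (a ⊗ b) = mtens (D a) (memb b).
Proof. by rewrite /comult_l tlift_tens //; apply: comult_l_bilinear. Qed.
Lemma comult_rE a b : comult_r D (a ⊗ b) = mtens (memb a) (D b).
Proof. by rewrite /comult_r tlift_tens //; apply: comult_r_bilinear. Qed.

Lemma comult_lM : {morph comult_l D : x y / x ** y}.
Proof.
move=> x y; elim/tensor_ind: x => [a b|x z hx hz]; last first.
  by rewrite smulDl !linearD /= smulDl hx hz.
elim/tensor_ind: y => [c d|x z hx hz]; last by rewrite smulDr !linearD /= smulDr hx hz.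
by rewrite smul_tens !comult_lE mtensM DM membM.
Qed.
Lemma comult_rM : {morph comult_r D : x y / x ** y}.
Proof.
move=> x y; elim/tensor_ind: x => [a b|x z hx hz]; last first.
  by rewrite smulDl !linearD /= smulDl hx hz.
elim/tensor_ind: y => [c d|x z hx hz]; last by rewrite smulDr !linearD /= smulDr hx hz.
by rewrite smul_tens !comult_rE mtensM DM membM.
Qed.

Hypothesis ndD : nondegenerate_hom D.

(** This is the uniqueness of the extension of D ⊗ iota to multipliers. Since D(A)(A ⊗ A) spans A ⊗
    A, both multipliers agree on all X ⊗ qv, and non-degeneracy removes v. *)
Lemma comult_l_cancel (m n : multiplier ((A ⊗ A) ⊗ A)) :
  (forall p q, m ** comult_l D (p ⊗ q) = n ** comult_l D (p ⊗ q)) -> m = n.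
Proof.
move=> e.
have E X q v : ml m (X ⊗ (q ** v)) = ml n (X ⊗ (q ** v)).
  have [s ->] := ndD.1 X.
  elim: s => [|p s IH]; first by rewrite big_nil tens0l !linear0.
  rewrite big_cons tensDl !mlD IH; congr (_ + _).
  by rewrite -mlE -ml_mtens -comult_lE -!ml_smul e.
apply: multiplier_eql => //; elim/tensor_ind => [X q|x y hx hy]; last by rewrite !mlD hx hy.
by apply: tensor_nondeg_eq => // Y v; rewrite -!ml_mulr smul_tens E.
Qed.

Lemma comult_r_cancel (m n : multiplier (A ⊗ (A ⊗ A))) :
  (forall p q, comult_r D (p ⊗ q) ** m = comult_r D (p ⊗ q) ** n) -> m = n.
Proof.
move=> e.
have E X q v : mr m ((v ** q) ⊗ X) = mr n ((v ** q) ⊗ X).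
  have [s ->] := ndD.2 X.
  elim: s => [|p s IH]; first by rewrite big_nil tens0r !linear0.
  rewrite big_cons tensDr !mrD IH; congr (_ + _).
  by rewrite -mrE -mr_mtens -comult_rE -!mr_smul e.
apply: multiplier_eqr => //; elim/tensor_ind => [q X|x y hx hy]; last by rewrite !mrD hx hy.
by apply: tensor_nondeg_eqr => // v Y; rewrite -!mr_mull smul_tens E.
Qed.

Variables T1 T2 : {linear (A ⊗ A)%type -> (A ⊗ A)%type}.
Hypothesis T1E : forall a b, memb (T1 (a ⊗ b)) = D a ** mtens (mone A) (memb b).
Hypothesis T2E : forall a b, memb (T2 (a ⊗ b)) = mtens (memb a) (mone A) ** D b.

(** The operator T2 ⊗ iota on [a] ⊗ x, rebracketed. Keeping [a] as a parameter makes the source A ⊗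
    A instead of a triple tensor product. *)
Definition T2leg (a : A) (x : A ⊗ A) : A ⊗ (A ⊗ A) :=
  tassoc (tmap (T2 \o tensl a) idfun x).
Lemma T2leg_linear a : linear (T2leg a).
Proof. by move=> k x y; rewrite /T2leg !linearP. Qed.
HB.instance Definition _ a :=
  GRing.isLinear.Build K _ _ _ (T2leg a) (T2leg_linear a).

Lemma T2legE a b c : T2leg a (b ⊗ c) = tassoc (T2 (a ⊗ b) ⊗ c).
Proof. by rewrite /T2leg tmapE. Qed.

(* (T2 (x) iota)(iota (x) T1) = (iota (x) T1)(T2 (x) iota) *)
Lemma pentagon : coassociative D ->
  forall a x, T2leg a (T1 x) = tmap idfun T1 (T2leg a x).
Proof.
move=> coass a x; elim/tensor_ind: x => [b c|x y hx hy]; last by rewrite !linearD /= hx hy.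
have [m [n [em en ea _]]] := coass b.
(* [m] is (D ⊗ iota)D(b), so this is (D ⊗ iota)(D(b)(1 ⊗ c)). With [R], both sides of the goal
   become (a ⊗ 1 ⊗ 1) D^(2)(b) (1 ⊗ 1 ⊗ c), once computed from [m] and once from [n]. *)
have L : comult_l D (T1 (b ⊗ c)) = m ** mtens (mone (A ⊗ A)%type) (memb c).
  apply: comult_l_cancel => p q; rewrite -comult_lM -mlE T1E ml_smul ml_mtens mlE.
  rewrite [in RHS]comult_lE -smulA mtensM mul1m -membM -comult_lE.
  by have [-> _] := em (p ⊗ (c ** q)).
have R : comult_r D (T2 (a ⊗ b)) = mtens (memb a) (mone (A ⊗ A)%type) ** n.
  apply: comult_r_cancel => p q; rewrite -comult_rM -mrE T2E mr_smul mr_mtens mrE.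
  rewrite [in RHS]comult_rE smulA mtensM mulm1 -membM -comult_rE.
  by have [_ ->] := en ((p ** a) ⊗ q).
rewrite T2legE /T2leg; set X := tmap _ _ _; set Y := tmap _ _ _.
have XE : memb X = mtens (mtens (memb a) (mone A)) (mone A) **
    (m ** mtens (mone (A ⊗ A)%type) (memb c)).
  rewrite -L /X; elim/tensor_ind: (T1 _) => [u v|x y hx hy].
    by rewrite tmapE /= /tensl comult_lE mtensM mul1m -T2E -memb_tens.
  by rewrite !linearD /= smulDr hx hy.
have YE : memb Y = mtens (memb a) (mone (A ⊗ A)%type) ** n **
     mtens (mone A) (mtens (mone A) (memb c)).
  rewrite -R /Y; elim/tensor_ind: (T2 _) => [u v|x y hx hy].
    by rewrite tassoc_tens tmapE comult_rE mtensM mulm1 -T1E -memb_tens.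
  by rewrite tensDl !linearD /= smulDl hx hy.
apply: tensor_nondeg_eq => // u v; rewrite -[u ⊗ v]tassocVK; move: (tassocV _) => z.
rewrite -tassocM -[X ** z]mlE -[RHS]mlE XE YE !ml_smul -mtens1.
by rewrite -tassoc_ml -ea -tassoc_ml.
Qed.

End MultiplierHopf.

(** * The counit, and the corner of a central group-like projection *)

Section MultiplierHopf.
Variables (K : numClosedFieldType) (A : starAlgType K).
Hypothesis ndA : Defs.nondegenerate A.
Let ndAA := nondegenerate_tensor ndA ndA.
Variable D : {linear A -> multiplier (A ⊗ A)}.
Hypothesis DM : {morph D : a b / a ** b}.
Variables T1 T2 G1 G2 : {linear (A ⊗ A)%type -> (A ⊗ A)%type}.
Hypothesis T1E : forall a b, memb (T1 (a ⊗ b)) = D a ** mtens (mone A) (memb b).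
Hypothesis T2E : forall a b, memb (T2 (a ⊗ b)) = mtens (memb a) (mone A) ** D b.
Hypothesis T1K : cancel T1 G1.
Hypothesis G1K : cancel G1 T1.
Hypothesis T2K : cancel T2 G2.
Hypothesis G2K : cancel G2 T2.
Hypothesis pentagonT : forall a x, T2leg T2 a (T1 x) = tmap idfun T1 (T2leg T2 a x).

Lemma T1_rmul a b c : T1 (a ⊗ (b ** c)) = tmap idfun (rmul c) (T1 (a ⊗ b)).
Proof.
by apply: (memb_inj ndAA); rewrite -memb_rmul2 !T1E -smulA mtensM mul1m membM.
Qed.

Lemma T1_T2 a b c : tmap (lmul a) idfun (T1 (b ⊗ c)) = tmap idfun (rmul c) (T2 (a ⊗ b)).
Proof.
by apply: (memb_inj ndAA); rewrite -memb_lmul1 -memb_rmul2 T1E T2E smulA.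
Qed.

Lemma T1_ml p x : T1 (tmap (lmul p) idfun x) = ml (D p) (T1 x).
Proof.
elim/tensor_ind: x => [a b|x y hx hy]; last by rewrite !linearD /= hx hy.
by apply: (memb_inj ndAA); rewrite tmapE -ml_memb !T1E DM smulA.
Qed.

Lemma T2leg_mulm a x : tmap idfun (@mulm K A) (T2leg T2 a x) = tmap (lmul a) idfun (T1 x).
Proof.
elim/tensor_ind: x => [b c|x y hx hy]; last by rewrite !linearD /= hx hy.
rewrite T1_T2 T2legE; elim/tensor_ind: (T2 _) => [u v|x y hx hy].
  by rewrite tassoc_tens !tmapE /= mulmE.
by rewrite tensDl !linearD /= hx hy.
Qed.

(** For y = a ⊗ b the two sides are a ⊗ mulm(G1(b ⊗ c)) and mulm(G2(a ⊗ b)) ⊗ c. Hence mulm(G1(b ⊗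
    c)) is a multiple of c and mulm(G2(a ⊗ b)) is the same multiple of a; this scalar, depending on
    b alone, is the counit of b. *)
Lemma mulm_inverse y c :
  tmap idfun (@mulm K A \o G1) (tassoc (y ⊗ c)) = mulm (G2 y) ⊗ c.
Proof.
rewrite -{1}(G2K y); elim/tensor_ind: (G2 y) => [a b|x z hx hz]; last first.
  by rewrite !linearD /= !tensDl !linearD /= hx hz.
rewrite -T2legE -(G1K (b ⊗ c)) pentagonT.
transitivity (tmap idfun (@mulm K A) (T2leg T2 a (G1 (b ⊗ c)))).
  elim/tensor_ind: (T2leg _ _ _) => [u v|x z hx hz]; last by rewrite !linearD /= hx hz.
  by rewrite !tmapE /= T1K.
by rewrite T2leg_mulm G1K tmapE mulmE.
Qed.

Variable phi : {scalar A}.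
Variable c0 : A.
Hypothesis c0P : phi c0 != 0.

(** The vector mulm(G2(c0 ⊗ b)) is a multiple of [c0]; [phi] only serves to read off the factor,
    which by [mulm_G1] does not depend on [phi] or [c0]. *)
Definition counit (b : A) : K := phi (mulm (G2 (c0 ⊗ b))) / phi c0.

Lemma counit_linear : scalar counit.
Proof.
by move=> k a b; rewrite /counit tensDr tensZr !linearP /= mulrDl mulrA.
Qed.
HB.instance Definition _ := GRing.isLinear.Build K A K _ counit counit_linear.

Lemma mulm_G1 b c : mulm (G1 (b ⊗ c)) = counit b *: c.
Proof.
have := congr1 (slicel phi) (mulm_inverse (c0 ⊗ b) c).
rewrite tassoc_tens tmapE /= !slicelE /counit => e.
by rewrite mulrC -scalerA -e scalerA mulVf // scale1r.
Qed.

Lemma slicer_counit y : slicer counit y = mulm (G2 y).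
Proof.
have := congr1 (slicer phi) (mulm_inverse y c0).
have -> : tmap idfun (@mulm K A \o G1) (tassoc (y ⊗ c0)) = slicer counit y ⊗ c0.
  elim/tensor_ind: y => [u v|x z hx hz].
    by rewrite tassoc_tens tmapE /= mulm_G1 slicerE tensZr tensZl.
  by rewrite tensDl !linearD /= tensDl hx hz.
by rewrite !slicerE; apply: scalerI.
Qed.

Lemma slicer_counit_T2 x : slicer counit (T2 x) = mulm x.
Proof. by rewrite slicer_counit T2K. Qed.

Lemma mulm_G2 b c : mulm (G2 (b ⊗ c)) = counit c *: b.
Proof. by rewrite -slicer_counit slicerE. Qed.

Lemma T2leg_counit a x : tmap idfun (slicel counit) (T2leg T2 a x) = tmap (lmul a) idfun x.
Proof.
elim/tensor_ind: x => [b c|x y hx hy]; last by rewrite !linearD /= hx hy.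
rewrite T2legE tmapE /= -[lmul a b]mulmE -slicer_counit_T2.
elim/tensor_ind: (T2 _) => [u v|x y hx hy].
  by rewrite tassoc_tens tmapE /= slicelE slicerE tensZr tensZl.
by rewrite tensDl !linearD /= tensDl hx hy.
Qed.

Lemma slicel_counit_T1 x : slicel counit (T1 x) = mulm x.
Proof.
elim/tensor_ind: x => [b c|x y hx hy]; last by rewrite !linearD /= hx hy.
have E (y : A ⊗ A) : tmap idfun (slicel counit \o T1) (tassoc (y ⊗ c)) = tmap idfun (rmul c) y.
  rewrite -(G2K y); elim/tensor_ind: (G2 y) => [u v|x z hx hz]; last first.
    by rewrite !linearD /= tensDl !linearD /= hx hz.
  rewrite -T1_T2 -T2leg_counit pentagonT -T2legE.
  elim/tensor_ind: (T2leg _ _ _) => [p q|x z hx hz]; last by rewrite !linearD /= hx hz.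
  by rewrite !tmapE.
have := congr1 (slicel phi) (E (c0 ⊗ b)).
by rewrite tassoc_tens !tmapE /= !slicelE mulmE; apply: scalerI.
Qed.

(** Multiplicativity of D gives D(p)(b ⊗ q) = D(p) T1(G1(b ⊗ q)) = T1((p ⊗ 1)G1(b ⊗ q)). Applying
    mulm o G1 produces the factor counit(b), and taking T1(y) = a ⊗ c0 gives the claim. *)
Lemma counitM a b : counit (a ** b) = counit a * counit b.
Proof.
have mulmW y : mulm (G1 (tmap (rmul b) idfun (T1 y))) = counit b *: mulm y.
  elim/tensor_ind: y => [p q|x z hx hz]; last first.
    by rewrite !linearD /= hx hz -scalerDr.
  have -> : tmap (rmul b) idfun (T1 (p ⊗ q)) = T1 (tmap (lmul p) idfun (G1 (b ⊗ q))).
    rewrite T1_ml G1K; apply: (memb_inj ndAA).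
    rewrite -memb_rmul1 T1E -ml_memb memb_tens -smulA; congr (_ ** _).
    by rewrite mtensM mul1m mulm1.
  rewrite T1K mulmE -smulZr -mulm_G1.
  elim/tensor_ind: (G1 _) => [u v|x z hx hz]; last by rewrite !linearD /= hx hz smulDr.
  by rewrite tmapE !mulmE /= smulA.
have := mulmW (G1 (a ⊗ c0)); rewrite G1K tmapE !mulm_G1 scalerA [counit b * _]mulrC.
by move/(congr1 phi); rewrite !linearZ /= => /(mulIf c0P).
Qed.

(* u ⊗ v |-> c S(u) v, for S the antipode: S(u) is a priori only a multiplier,
   whereas c S(u) = (iota (x) eps)(T2^-1 (c ⊗ u)) lies in A. *)
Definition antipode_mul (c : A) (x : A ⊗ A) : A :=
  mulm (tmap (slicer counit \o G2 \o tensl c) idfun x).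

Lemma antipode_mul_linear c : linear (antipode_mul c).
Proof. by move=> k x y; rewrite /antipode_mul !linearP. Qed.
HB.instance Definition _ c :=
  GRing.isLinear.Build K _ _ _ (antipode_mul c) (antipode_mul_linear c).

Lemma antipode_mulE c u v : antipode_mul c (u ⊗ v) = slicer counit (G2 (c ⊗ u)) ** v.
Proof. by rewrite /antipode_mul tmapE mulmE. Qed.

(** This is S(a_1)a_2 = counit(a)1, covered by c and z. Write c ⊗ a = T2(x); the pentagon relation
    puts T2 outermost, where G2 cancels it. *)
Lemma antipode_mul_T1 c a z : antipode_mul c (T1 (a ⊗ z)) = counit a *: (c ** z).
Proof.
pose Psi x := mulm (tmap (slicer counit \o G2) idfun (tassocV x)).
have PsiD x y : Psi (x + y) = Psi x + Psi y by rewrite /Psi !linearD.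
have -> : antipode_mul c (T1 (a ⊗ z)) = Psi (c ⊗ T1 (a ⊗ z)).
  elim/tensor_ind: (T1 _) => [u v|x y hx hy].
    by rewrite antipode_mulE /Psi tassocVE tmapE mulmE.
  by rewrite tensDr PsiD -hx -hy /antipode_mul !linearD.
have Psi_leg p y : Psi (T2leg T2 p y) = p ** slicel counit y.
  elim/tensor_ind: y => [u v|x y hx hy]; last by rewrite !linearD /= PsiD hx hy smulDr.
  rewrite T2legE /Psi tassocK tmapE mulmE /= T2K.
  by rewrite slicerE slicelE smulZl smulZr.
have E x : Psi (tmap idfun T1 (tassoc (T2 x ⊗ z))) = mulm x ** z.
  elim/tensor_ind: x => [p q|x y hx hy].
    by rewrite -T2legE -pentagonT Psi_leg slicel_counit_T1 !mulmE smulA.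
  by rewrite !linearD /= tensDl !linearD /= PsiD smulDl hx hy.
have := E (G2 (c ⊗ a)); rewrite G2K tassoc_tens tmapE /= => ->.
by rewrite mulm_G2 smulZl.
Qed.

(** * The projection [h] and the counit *)

Hypothesis Dstar : {morph D : a / star a}.
Variable h : A.
Hypothesis hh : projection h.
Hypothesis hc : central h.
Hypothesis h0 : h != 0.
Hypothesis hD : D h ** mtens (mone A) (memb h) = memb (h ⊗ h).

Let hK : h ** h = h. Proof. by case: hh. Qed.

Lemma T1_hh : T1 (h ⊗ h) = h ⊗ h.
Proof. by apply: (memb_inj ndAA); rewrite T1E hD. Qed.

(** T1 fixes h ⊗ h, so mulm o G1 sends h ⊗ h to hh = h as well as to counit(h)h. *)
Lemma counit_group_like : counit h = 1.
Proof.
have := mulm_G1 h h; rewrite -{1}T1_hh T1K mulmE hK => /eqP.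
by rewrite -subr_eq0 -{1}[h]scale1r -scalerBl scaler_eq0 (negPf h0) orbF subr_eq0 => /eqP.
Qed.

(** Products span A: a = counit(h)a = mulm(G1(h ⊗ a)). *)
Lemma scalar_products0 (f : {scalar A}) :
  (forall a b, f (a ** b) = 0) -> forall a, f a = 0.
Proof.
move=> f0 a; have := mulm_G1 h a; rewrite counit_group_like scale1r => <-.
elim/tensor_ind: (G1 _) => [u v|x y hx hy]; first by rewrite mulmE f0.
by rewrite !linearD /= hx hy addr0.
Qed.

(** * A left integral does not vanish at [h] *)

Section LeftIntegral.
Variable psi : {scalar A}.
Hypothesis psil : forall a, is_slicer psi (D a) (psi a *: mone A).

Lemma slicer_T2 a b : slicer psi (T2 (a ⊗ b)) = psi b *: a.
Proof.
have [_ [x xE e]] := psil b a; rewrite [RHS]e; congr (slicer psi _).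
by apply: (memb_inj ndAA); rewrite T2E.
Qed.

Lemma slicer_comult_h (X Y : A ⊗ A) : (forall x, psi (x ** h) = 0) ->
  slicer psi (mr (D h) X ** Y) = 0.
Proof.
(* T2 only puts a ⊗ 1 on the left of D; the form needed for Y comes from applying the involution to
   T2. *)
move=> psih; rewrite -(G2K X) -[Y]starK -(G2K (star Y)).
elim/tensor_ind: (G2 (star Y)) => [c d|x y hx hy]; last first.
  by rewrite linearD /= starD smulDr linearD /= hx hy addr0.
elim/tensor_ind: (G2 X) => [a b|x y hx hy]; last first.
  by rewrite linearD /= mrD smulDl linearD /= hx hy addr0.
have -> : mr (D h) (T2 (a ⊗ b)) ** star (T2 (c ⊗ d)) =
    tmap (rmul (star c)) idfun (T2 (a ⊗ (b ** h ** star d))).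
  apply: (memb_inj ndAA); rewrite membM memb_star -mr_memb -memb_rmul1 !T2E.
  by rewrite starM star_mtens star_mone -memb_star -Dstar !DM !smulA.
rewrite slicer_map -[slicer _ _]/(slicer psi _) slicer_T2.
by rewrite -smulA -hc smulA psih scale0r linear0.
Qed.

Hypothesis psi_pos : forall a, 0 <= psi (star a ** a).

(** The degenerate case of Cauchy-Schwarz: when psi(b^* b) = 0, the nonnegative psi((tb + a)^* (tb +
    a)) is affine along t real and along t imaginary, so both slopes vanish. *)
Lemma psi_null_right a b : psi (star b ** b) = 0 -> psi (star a ** b) = 0.
Proof.
move=> b0; set u := psi _.
have pos t : 0 <= psi (star a ** a) + (t * u + t^* * psi (star b ** a)).
  have := psi_pos (t *: b + a).
  rewrite starP !smulDl !smulDr !smulZl !smulZr !linearD !linearZ /= b0 !mulr0 add0r.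
  by move=> tpos; rewrite addrC [t * u + _]addrC -addrA.
have zero (w al : K) : (forall s, s \is Num.real -> 0 <= al + s * w) -> w = 0.
  move=> wpos; have al0 : 0 <= al by have := wpos 0 (real0 _); rewrite mul0r addr0.
  have wr : w \is Num.real.
    have := wpos 1 (real1 _); rewrite mul1r => /ger0_real.
    by rewrite rpredDl // ger0_real.
  (* This value of s makes al + s w equal to -1. *)
  apply: contrapT => /eqP w0; have := wpos (- (al + 1) / w).
  have ar : al \is Num.real by rewrite ger0_real.
  rewrite rpredM ?rpredN ?rpredV ?rpredD ?rpred1 // => /(_ isT).
  by rewrite divfK // opprD addrA subrr add0r oppr_ge0 ler10.
have e1 : u + psi (star b ** a) = 0.
  by apply: (zero _ (psi (star a ** a))) => s sr; have := pos s; rewrite (CrealP sr) mulrDr.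
have e2 : 'i * (u - psi (star b ** a)) = 0.
  apply: (zero _ (psi (star a ** a))) => s sr; have := pos (s * 'i).
  by rewrite rmorphM /= (CrealP sr) conjCi mulrN mulNr -mulrBr mulrA.
have /eqP : u - psi (star b ** a) = 0.
  by move/eqP: e2; rewrite mulf_eq0 (negPf (neq0Ci _)) => /eqP.
rewrite subr_eq0 => /eqP e; move: e1; rewrite -e -mulr2n => /eqP.
by rewrite mulrn_eq0 => /eqP.
Qed.

(* Otherwise psi vanishes on Ah, so the second leg of D(h) lies in the two-sided
   ideal J of all v with psi(xvy) = 0, and S(h_1)h_2 = 1 gives J = A. *)
Lemma integral_group_like_neq0 : (exists a, psi a != 0) -> psi h != 0.
Proof.
case=> a0; apply: contraNneq => psih0; apply/eqP; move: a0.
have psih x : psi (x ** h) = 0.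
  by rewrite -[x]starK; apply: psi_null_right; case: hh => _ ->; rewrite hK.
pose f x y : {scalar A} := psi \o lmul x \o rmul y.
pose J v := forall x y, f x y v = 0.
have sJ : subspace J.
  split=> [x y|k u v Ju Jv x y]; first exact: linear0.
  by rewrite linearP Ju Jv mulr0 addr0.
have Jleg z (g : {scalar A}) : J (slicel g (T1 (h ⊗ z))).
  move=> x y; rewrite -(slice_comm g (f x y)).
  suff -> : slicer (f x y) (T1 (h ⊗ z)) = 0 by rewrite linear0.
  apply: ndA.1 => e; apply: ndA.2 => c.
  have <- : slicer psi ((c ⊗ x) ** T1 (h ⊗ z) ** (e ⊗ y)) =
      c ** (slicer (f x y) (T1 (h ⊗ z)) ** e).
    elim/tensor_ind: (T1 _) => [u v|X Y hX hY].
      by rewrite !smul_tens !slicerE smulZl smulZr /= /lmul /rmul !smulA.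
    by rewrite smulDr !smulDl !linearD /= smulDl smulDr hX hY.
  rewrite -(slicer_comult_h (c ⊗ x) (e ⊗ (z ** y)) psih); congr slicer.
  apply: (memb_inj ndAA); rewrite !membM T1E -mr_memb -!smulA; congr (_ ** (_ ** _)).
  by rewrite !memb_tens mtensM mul1m membM.
(* The second legs of T1(h ⊗ z) can all be taken in [J] at once, and c z is the sum of the c S(u_i)
   v_i. *)
have Jprod x y c z : psi (x ** (c ** z ** y)) = 0.
  have [n [u [v [Jv E]]]] := slices_in_subspace sJ (Jleg z).
  have := antipode_mul_T1 c h z; rewrite counit_group_like scale1r => <-.
  rewrite E -[LHS]/((f x y \o antipode_mul c) _) linear_sum big1 //= => i _.
  rewrite antipode_mulE -[RHS](Jv i (x ** slicer counit (G2 (c ⊗ u i))) y).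
  by rewrite /f /= /lmul /rmul !smulA.
(* Products span A, so fourfold products x c z y span A too. *)
apply: scalar_products0 => x; apply: (scalar_products0 (f := psi \o lmul x)) => b y /=.
by apply: (scalar_products0 (f := f x y)) => c z; apply: Jprod.
Qed.

End LeftIntegral.

(** * How T1 and T2 interact with h ⊗ h *)

Let z0 : A ⊗ A := h ⊗ h.

Lemma commute_h1 m : mtens (memb h) (mone A) ** m = m ** mtens (memb h) (mone A).
Proof.
apply: (central_multiplier _ ndAA); elim/tensor_ind => [a b|x y hx hy].
  by rewrite ml_mtens mr_mtens mlE mrE hc.
by rewrite mlD mrD hx hy.
Qed.
Lemma commute_h2 m : mtens (mone A) (memb h) ** m = m ** mtens (mone A) (memb h).
Proof.
apply: (central_multiplier _ ndAA); elim/tensor_ind => [a b|x y hx hy].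
  by rewrite ml_mtens mr_mtens mlE mrE hc.
by rewrite mlD mrD hx hy.
Qed.
Lemma memb_z0 : memb z0 = mtens (memb h) (mone A) ** mtens (mone A) (memb h).
Proof. by rewrite mtensM mul1m mulm1 memb_tens. Qed.
Lemma commute_hh m : memb z0 ** m = m ** memb z0.
Proof. by rewrite memb_z0 -smulA commute_h2 smulA (commute_h1 m) -smulA. Qed.

Lemma z0K : z0 ** z0 = z0.
Proof. by rewrite smul_tens hK. Qed.

Lemma star_z0 : star z0 = z0.
Proof. by rewrite star_tens; case: hh => _ ->. Qed.

Lemma z0_central : central z0.
Proof. by move=> x; apply: (memb_inj ndAA); rewrite !membM commute_hh. Qed.

Lemma hD' : mtens (mone A) (memb h) ** D h = memb z0.
Proof. by rewrite commute_h2 hD. Qed.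

Lemma T1_z0 x : T1 (x ** z0) = T1 x ** z0.
Proof.
elim/tensor_ind: x => [a b|x y hx hy]; last by rewrite !(smulDl, linearD) /= hx hy.
apply: (memb_inj ndAA); rewrite [RHS]membM smul_tens !T1E DM hc membM.
have -> : mtens (mone A) (memb h ** memb b) =
    mtens (mone A) (memb h) ** mtens (mone A) (memb b) by rewrite mtensM mul1m.
by rewrite -!smulA; congr (_ ** _); rewrite smulA hD commute_hh.
Qed.

(** Only h ⊗ 1 can be moved past D(b), which leaves (h ⊗ 1)D(h) = T2(h ⊗ h) as the factor; that it
    equals h ⊗ h is not yet available. *)
Lemma T2_z0 x : T2 (x ** z0) = T2 x ** T2 z0.
Proof.
elim/tensor_ind: x => [a b|x y hx hy]; last by rewrite !(smulDl, linearD) /= hx hy.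
apply: (memb_inj ndAA); rewrite [RHS]membM smul_tens !T2E DM membM.
have -> : mtens (memb a ** memb h) (mone A) =
    mtens (memb a) (mone A) ** mtens (memb h) (mone A) by rewrite mtensM mul1m.
by rewrite -!smulA; congr (_ ** _); rewrite smulA commute_h1 -smulA.
Qed.

Lemma h1_z0 : mtens (memb h) (mone A) ** memb z0 = memb z0.
Proof. by rewrite memb_lmul1 tmapE /= /lmul hK. Qed.
Lemma h2_z0 : mtens (mone A) (memb h) ** memb z0 = memb z0.
Proof. by rewrite memb_lmul2 tmapE /= /lmul hK. Qed.

Lemma comult_h_z0 : D h ** memb z0 = memb z0.
Proof. by rewrite {1}memb_z0 commute_h1 smulA hD -commute_h1 h1_z0. Qed.

Lemma T2_z0_z0 : T2 z0 ** z0 = z0.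
Proof.
by apply: (memb_inj ndAA); rewrite membM T2E -smulA comult_h_z0 h1_z0.
Qed.

(** * The Hopf *-algebra structure on Ah *)

Local Notation Ah := (corner hh hc).
Local Notation cval := (@corner_val K A h hh hc).
Local Notation incl := (@corner_tensor_incl K A h hh hc).

Lemma cval_linear : linear cval.
Proof. by []. Qed.
HB.instance Definition _ := GRing.isLinear.Build K Ah A _ cval cval_linear.

Lemma cvalM (u v : Ah) : cval (u ** v) = cval u ** cval v.
Proof. by []. Qed.
Lemma cval_h (u : Ah) : cval u ** h = cval u.
Proof. by have /asboolP[a ->] := valP u; rewrite -smulA hK. Qed.
Lemma cval_star (u : Ah) : cval (star u) = star (cval u).
Proof. by []. Qed.

Fact to_corner_subproof a : a ** h \in corner_pred h.
Proof. by apply/asboolP; exists a. Qed.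
Definition to_corner (a : A) : Ah := Corner hh hc (to_corner_subproof a).
Lemma to_corner_linear : linear to_corner.
Proof. by move=> k a b; apply: val_inj; apply: smulPl. Qed.
HB.instance Definition _ := GRing.isLinear.Build K A Ah _ to_corner to_corner_linear.

Lemma cval_inj : injective cval. Proof. exact: val_inj. Qed.
Lemma cvalK (u : Ah) : to_corner (cval u) = u.
Proof. by apply: cval_inj; apply: cval_h. Qed.
HB.instance Definition _ := GRing.Linear.copy incl (tmap cval cval).

Lemma inclE u v : incl (u ⊗ v) = cval u ⊗ cval v.
Proof. exact: tmapE. Qed.

Definition to_cornerT : A ⊗ A -> Ah ⊗ Ah := tmap to_corner to_corner.
HB.instance Definition _ := GRing.Linear.copy to_cornerT (tmap to_corner to_corner).

(** The map a |-> ah is a linear retraction of A onto Ah; tensored with itself it makes the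
    inclusion of Ah ⊗ Ah injective. *)
Lemma inclK x : to_cornerT (incl x) = x.
Proof.
elim/tensor_ind: x => [u v|x y hx hy]; last by rewrite !linearD /= hx hy.
by rewrite inclE /to_cornerT tmapE /= !cvalK.
Qed.
Lemma to_cornerTK x : incl (to_cornerT x) = x ** z0.
Proof.
elim/tensor_ind: x => [u v|x y hx hy]; last by rewrite smulDl !linearD /= hx hy.
by rewrite /to_cornerT tmapE inclE smul_tens.
Qed.
Lemma incl_inj : injective incl. Proof. exact: can_inj inclK. Qed.

Lemma inclM x y : incl (x ** y) = incl x ** incl y.
Proof.
elim/tensor_ind: x => [a b|x z hx hz]; last by rewrite smulDl !linearD /= smulDl hx hz.
elim/tensor_ind: y => [c d|x z hx hz]; last by rewrite smulDr !linearD /= smulDr hx hz.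
by rewrite smul_tens !inclE smul_tens.
Qed.
Lemma incl_star x : incl (star x) = star (incl x).
Proof.
elim/tensor_ind: x => [a b|x y hx hy]; last by rewrite starD !linearD /= starD hx hy.
by rewrite star_tens !inclE star_tens.
Qed.
Lemma incl_z0 x : incl x ** z0 = incl x.
Proof. by rewrite -to_cornerTK inclK. Qed.

(** For a in Ah, D(a)(1 ⊗ h) = D(a)D(h)(1 ⊗ h) = D(a)(h ⊗ h). Taking the T1 form gives an element of
    A ⊗ A directly rather than a multiplier. *)
Definition comult0 (u : Ah) : Ah ⊗ Ah := to_cornerT (T1 (cval u ⊗ h)).
Lemma comult0_linear : linear comult0.
Proof. by move=> k u v; rewrite /comult0 linearP tensDl tensZl !linearP. Qed.
HB.instance Definition _ := GRing.isLinear.Build K Ah _ _ comult0 comult0_linear.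

Lemma incl_comult0 u : incl (comult0 u) = T1 (cval u ⊗ h).
Proof. by rewrite to_cornerTK -T1_z0 smul_tens cval_h hK. Qed.

Lemma memb_comult0 u : memb (incl (comult0 u)) = D (cval u) ** memb z0.
Proof.
by rewrite incl_comult0 T1E -{1}[cval u]cval_h DM -smulA hD -{1}comult_h_z0
  smulA -DM cval_h.
Qed.

Lemma comult0_star_hom : star_hom comult0.
Proof.
split; first exact: comult0_linear.
- move=> u v; apply: incl_inj; apply: (memb_inj ndAA).
  rewrite inclM membM !memb_comult0 cvalM DM -!smulA; congr (_ ** _).
  by rewrite commute_hh -smulA -membM z0K.
- move=> u; apply: incl_inj; apply: (memb_inj ndAA).
  by rewrite incl_star memb_star !memb_comult0 starM -memb_star star_z0 commute_hh
    cval_star Dstar.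
Qed.

Local Notation one0 := (corner_one hh hc).

Lemma corner_identity : is_identity one0.
Proof.
move=> u; split; apply: cval_inj; last exact: cval_h.
by rewrite cvalM -[cval one0]/h -hc; apply: cval_h.
Qed.

Lemma comult0_one : comult0 one0 = one0 ⊗ one0.
Proof. by apply: incl_inj; rewrite incl_comult0 inclE; apply: T1_hh. Qed.

(** The same coproduct expressed by T2, as required by the right counit identity and by the pentagon
    relation. *)
Lemma incl_comult0_T2 u : incl (comult0 u) = tmap idfun (rmul h) (T2 (h ⊗ cval u)).
Proof.
apply: (memb_inj ndAA); rewrite memb_comult0 -memb_rmul2 T2E memb_z0 smulA.
by rewrite commute_h1.
Qed.

Let counit0 : {scalar Ah} := counit \o cval.

Lemma counit0l u : slicel counit0 (comult0 u) = u.
Proof.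
apply: cval_inj; rewrite -slicel_map -/(incl _) incl_comult0 slicel_counit_T1 mulmE.
exact: cval_h.
Qed.

Lemma counit0r u : slicer counit0 (comult0 u) = u.
Proof.
apply: cval_inj; rewrite -slicer_map -/(incl _) incl_comult0_T2 slicer_map /=.
(* The extra h in the second leg is invisible to the counit, which is multiplicative with value 1 at
   h. *)
have -> x : slicer (counit \o rmul h) x = slicer counit x.
  elim/tensor_ind: x => [a b|x y hx hy]; last by rewrite !linearD /= hx hy.
  by rewrite !slicerE /= /rmul counitM counit_group_like mulr1.
by rewrite slicer_counit_T2 mulmE -hc cval_h.
Qed.

Definition comult_h (a : A) : A ⊗ A := T1 (a ⊗ h).
Lemma comult_h_linear : linear comult_h.
Proof. by move=> k a b; rewrite /comult_h tensDl tensZl linearP. Qed.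
HB.instance Definition _ := GRing.isLinear.Build K _ _ _ comult_h comult_h_linear.

Definition incl3 : Ah ⊗ (Ah ⊗ Ah) -> A ⊗ (A ⊗ A) := tmap cval incl.
HB.instance Definition _ := GRing.Linear.copy incl3 (tmap cval incl).

(** Inside A ⊗ (A ⊗ A) both sides are brought to expressions in T2(h ⊗ u), using the pentagon
    relation at h and T1(u ⊗ h). *)
Lemma comult0_coassoc u :
  tassoc (tmap comult0 idfun (comult0 u)) = tmap idfun comult0 (comult0 u).
Proof.
have incl3_inj : injective incl3.
  apply: (can_inj (g := tmap to_corner to_cornerT)) => x.
  elim/tensor_ind: x => [a y|x y hx hy]; last by rewrite !linearD /= hx hy.
  by rewrite /incl3 !tmapE /= cvalK inclK.
apply: incl3_inj.
have -> x : incl3 (tmap idfun comult0 x) = tmap idfun comult_h (incl x).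
  elim/tensor_ind: x => [a b|x y hx hy]; last by rewrite !linearD /= hx hy.
  by rewrite inclE /incl3 !tmapE /= incl_comult0.
have -> : incl3 (tassoc (tmap comult0 idfun (comult0 u))) =
    tmap idfun (tmap (rmul h) idfun) (T2leg T2 h (incl (comult0 u))).
  elim/tensor_ind: (comult0 u) => [a b|x y hx hy]; last by rewrite !linearD /= hx hy.
  rewrite inclE T2legE tmapE /=.
  transitivity (tassoc (incl (comult0 a) ⊗ cval b)).
    elim/tensor_ind: (comult0 a) => [p q|x y hx hy].
      by rewrite tassoc_tens /incl3 tmapE /= !inclE tassoc_tens.
    by rewrite !tensDl !linearD /= !tensDl !linearD /= hx hy.
  rewrite incl_comult0_T2; elim/tensor_ind: (T2 _) => [p q|x y hx hy].
    by rewrite tmapE /= !tassoc_tens tmapE /= tmapE.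
  by rewrite !linearD /= !tensDl !linearD /= hx hy.
rewrite {1}incl_comult0 pentagonT T2legE incl_comult0_T2.
elim/tensor_ind: (T2 _) => [p q|x y hx hy]; last first.
  by rewrite tensDl !linearD /= hx hy.
(* What remains is D(q)(1 ⊗ h)(h ⊗ 1) = D(qh)(1 ⊗ h), an instance of group-likeness. *)
rewrite tassoc_tens !tmapE /= /comult_h; congr (_ ⊗ _); apply: (memb_inj ndAA).
rewrite -memb_rmul1 !T1E /rmul DM -!smulA; congr (_ ** _).
by rewrite -commute_h1 -memb_z0 -commute_h2 hD'.
Qed.

Let G0 : {linear (Ah ⊗ Ah)%type -> (Ah ⊗ Ah)%type} := to_cornerT \o G1 \o incl.

(** The Galois map of Ah is the restriction of T1; its inverse restricts as well because T1 commutes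
    with multiplication by h ⊗ h. *)
Lemma incl_galois x : incl (galois comult0 x) = T1 (incl x).
Proof.
elim/tensor_ind: x => [u v|x y hx hy]; last by rewrite !linearD /= hx hy.
rewrite galoisE /= inclE -[cval v]cval_h hc T1_rmul -incl_comult0.
elim/tensor_ind: (comult0 u) => [a b|x y hx hy]; last by rewrite !linearD /= hx hy.
by rewrite !inclE !tmapE inclE.
Qed.

Lemma galois0K : cancel (galois comult0) G0.
Proof. by move=> x; rewrite /G0 /= incl_galois T1K inclK. Qed.
Lemma G0K : cancel G0 (galois comult0).
Proof.
move=> x; apply: incl_inj.
by rewrite incl_galois /G0 /= to_cornerTK T1_z0 G1K incl_z0.
Qed.

Lemma counit0_one : counit0 one0 = 1.
Proof. exact: counit_group_like. Qed.

Lemma corner_hopf : hopf_star_algebra one0 comult0.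
Proof.
have [_ comult0M _] := comult0_star_hom.
split; [exact: corner_identity|exact: comult0_star_hom|exact: comult0_one
  |exact: comult0_coassoc|].
exists counit0, (antipode counit0 one0 G0); split; split.
- exact: linearP.
- exact: counit0_one.
- by move=> u v; apply: counitM.
- exact: counit0l.
- exact: counit0r.
- exact: linearP.
- exact: (conv_antipodel counit0 corner_identity galois0K G0K).
- exact: (conv_antipoder comult0_coassoc counit0l counit0r one0 galois0K G0K).
Qed.

Lemma T2_hh : T2 z0 = z0.
Proof.
have incl_galois' x : incl (galois' comult0 one0 x) = T2 (incl x) ** z0.
  elim/tensor_ind: x => [u v|x y hx hy]; last first.
    by rewrite /galois' !linearD /= smulDl -hx -hy.
  rewrite /galois' tmapE /= mulmE inclM /tinl !inclE.
  apply: (memb_inj ndAA); rewrite !membM memb_comult0 T2E memb_tens smulA -smulA.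
  have -> : mtens (memb (cval u)) (memb h) =
      mtens (memb (cval u)) (mone A) ** mtens (mone A) (memb h).
    by rewrite mtensM mul1m mulm1.
  rewrite -!smulA; congr (_ ** _).
  by rewrite commute_h2 -smulA -commute_h2 h2_z0.
pose y := G2 z0.
(* This places T2^-1(h ⊗ h) in Ah ⊗ Ah: T2(y z0) = z0 T2(z0) = z0 = T2(y). *)
have yz0 : y ** z0 = y.
  by apply: (can_inj T2K); rewrite T2_z0 G2K -z0_central T2_z0_z0.
have y0E : incl (to_cornerT y) = y by rewrite to_cornerTK yz0.
suff e : to_cornerT y = one0 ⊗ one0.
  have yE : y = z0 by rewrite -y0E e inclE.
  by rewrite -{1}yE G2K.
(* The second Galois map of Ah is T2 followed by multiplication by z0; it sends both y and h ⊗ h to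
   z0. *)
apply: (galois'_inj comult0_coassoc counit0l counit0r corner_identity galois0K G0K).
apply: incl_inj; rewrite !incl_galois' y0E G2K inclE z0K; exact/esym/T2_z0_z0.
Qed.

Lemma corner_haar (psi : {scalar A}) :
  (forall a, is_slicer psi (D a) (psi a *: mone A)) -> nonzero_positive psi ->
  is_haar one0 comult0 (psi \o cval).
Proof.
move=> psil [_ psi0 psi_pos].
pose psi_h : {scalar Ah} := psi \o cval.
have [_ comult0M _] := comult0_star_hom.
have psih0 : psi_h one0 != 0 by apply: integral_group_like_neq0.
have left_inv u : slicer psi_h (comult0 u) = psi_h u *: one0.
  apply: cval_inj; rewrite -slicer_map -/(incl _) linearZ /=.
  (* The factor 1 ⊗ h must disappear before left invariance of psi on A applies. It is absorbed
     because T2(h ⊗ u) = T2(h ⊗ u)(h ⊗ h) by [T2_hh]. *)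
  have -> : incl (comult0 u) = T2 (h ⊗ cval u); last exact: slicer_T2.
  have e : T2 (h ⊗ cval u) = T2 (h ⊗ cval u) ** z0.
    by rewrite -T2_hh -T2_z0 smul_tens hK cval_h.
  rewrite incl_comult0_T2 e; apply: (memb_inj ndAA).
  by rewrite -memb_rmul2 membM -smulA -commute_h2 h2_z0.
split.
- split; [exact: linearP|by exists one0|by move=> u; apply: psi_pos].
- exact: left_inv.
- exact: (left_integral_right comult0_coassoc counit0l counit0r corner_identity
    comult0M comult0_one counit0_one galois0K G0K left_inv psih0).
Qed.

End MultiplierHopf.

Lemma central_corner_compact (K : numClosedFieldType) (A : starAlgType K)
    (Delta : A -> multiplier (A ⊗ A)) (h : A) (hp : projection h) (hc : central h) :
  algebraic_quantum_group Delta -> group_like_projection Delta h ->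
  exists Delta0 : corner hp hc -> (corner hp hc ⊗ corner hp hc)%type,
    [/\ forall a, memb (corner_tensor_incl (Delta0 a)) = Delta (corner_val a) ** memb (h ⊗ h),
        compact_quantum_group (corner_one hp hc) Delta0
      & forall phi : A -> K, positive_left_integral Delta phi ->
          is_haar (corner_one hp hc) Delta0 (fun a => phi (corner_val a))].
Proof.
move=> [[ndA [Dlin DM Dstar] ndD coass [b1 b2]] [phi0 phi0P]] [h0 _ hD].
pose D : {linear A -> multiplier (A ⊗ A)} :=
  HB.pack Delta (GRing.isLinear.Build _ _ _ _ Delta Dlin).
rewrite -[Delta]/(GRing.Linear.sort D) in DM Dstar ndD coass b1 b2 hD *.
have [T1 [G1 [T1K G1K T1E]]] := bijective_onto_tensor_linear ndA (comult1_bilinear D) b1.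
have [T2 [G2 [T2K G2K T2E]]] := bijective_onto_tensor_linear ndA (comult2_bilinear D) b2.
have pent := pentagon ndA DM ndD T1E T2E coass.
have haar psi : positive_left_integral D psi ->
    is_haar (corner_one hp hc) (@comult0 K A T1 h hp hc) (fun a => psi (corner_val a)).
  move=> [psi_pos psil]; have [psi_lin [c0 c0P] _] := psi_pos.
  pose psi' : {scalar A} := HB.pack psi (GRing.isLinear.Build _ _ _ _ psi psi_lin).
  (* The integral plays two roles: the nonzero functional that defines the counit, and the
     functional restricted to Ah. As [comult0] does not involve it, every integral is treated with
     the same coproduct. *)
  exact: (corner_haar (phi := psi') (psi := psi') ndA DM T1E T2E T1K G1K T2K G2K
    pent c0P Dstar hp hc h0 hD psil psi_pos).
exists (@comult0 K A T1 h hp hc); split=> //; first exact: (memb_comult0 ndA DM T1E hD).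
have [[phi_lin [c0 c0P] _] _] := phi0P.
pose phi : {scalar A} := HB.pack phi0 (GRing.isLinear.Build _ _ _ _ phi0 phi_lin).
split; last by exists (fun a => phi0 (corner_val a)); apply: haar.
exact: (corner_hopf (phi := phi) ndA DM T1E T2E T1K G1K T2K G2K pent c0P Dstar
  hp hc h0 hD).
Qed.

Theorem theorem2p2 (R : realType) (A : starAlgType R[i])
    (Delta : A -> multiplier (A ⊗ A)) (hA : algebraic_quantum_group Delta)
    (h : A) (hh : group_like_projection Delta h) (hc : central h) :
  let hp := group_like_projection_proj hh in
  exists Delta0 : corner hp hc -> (corner hp hc ⊗ corner hp hc)%type,
    [/\ forall a, memb (corner_tensor_incl (Delta0 a)) = Delta (corner_val a) ** memb (h ⊗ h),
        compact_quantum_group (corner_one hp hc) Delta0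
      & forall phi : A -> R[i], positive_left_integral Delta phi ->
          is_haar (corner_one hp hc) Delta0 (fun a => phi (corner_val a))].
Proof.
by move=> hp; apply: central_corner_compact.
Qed.
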